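(* Let $R$ and $S$ be rings. A morphism of ringed spaces $\varphi:\mathrm{NCSpec}(S)\to\mathrm{NCSpec}(R)$ is induced by a ring homomorphism $R\to S$ (that is, $\varphi=(\hat\theta,\hat\theta^\#)$ for some ring homomorphism $\theta:R\to S$) if and only if $\varphi$ is prim. Thus $R\mapsto\mathrm{NCSpec}(R)$ (with $\theta\mapsto(\hat\theta,\hat\theta^\#)$) is a fully faithful contravariant embedding of the category of rings into the category of ringed spaces and prim morphisms.
   Context: Rings are unital, not necessarily commutative, the zero ring (with $1=0$) is allowed, and ring homomorphisms preserve identity elements. A ringed space is a topological space with a sheaf of (not necessarily commutative) rings; a morphism $(X,\mathcal O_X)\to(Y,\mathcal O_Y)$ is a pair $(\phi,\phi^\#)$ with $\phi:X\to Y$ continuous and $\phi^\#:\mathcal O_Y\to\phi_*\mathcal O_X$ a morphism of sheaves of rings. Localization: for a subset $A$ of a ring $R$, $\alpha_A:R\to loc(R,A)$ denotes the universal ring homomorphism sending every element of $A$ to a unit: any ring homomorphism $R\to T$ sending every $a\in A$ to a unit factors uniquely through $\alpha_A$. Write $A\preceq B$ if $\alpha_B(a)$ is a unit in $loc(R,B)$ for all $a\in A$; then $p_{BA}:loc(R,A)\to loc(R,B)$ is the unique homomorphism with $p_{BA}\alpha_A=\alpha_B$. The relation $\preceq$ is a preorder on the set $L_0(R)$ of finite subsets of $R$; $L(R)$ is the poset of equivalence classes for $A\sim B\iff A\preceq B\preceq A$, and $R_A$ denotes the class of $A$, so $R_A\le R_B\iff A\preceq B$. The space $\mathrm{NCSpec}(R)$: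 give $L(R)$ the Alexandrov topology (open sets are the upper sets), with base $U_E=\{R_F:R_F\ge R_E\}$, and the unique sheaf of rings $\mathcal O$ with $\mathcal O(U_E)=loc(R,E)$ and restriction maps $p_{FE}$ for $U_F\subset U_E$. For a topological space $X$, its soberification $S(X)$ is the set of irreducible (in particular nonempty) closed subsets of $X$ with open sets $\widetilde U=\{C\in S(X):C\cap U\ne\varnothing\}$, $U$ open in $X$; $U\mapsto\widetilde U$ is an isomorphism of lattices of open sets. $\mathrm{NCSpec}(R)$ is $S(L(R))$ with the sheaf $\mathcal O(\widetilde U):=\mathcal O(U)$. Induced morphisms: for a ring homomorphism $\theta:R\to S$, and $E\subset R$ finite, $\theta_E:loc(R,E)\to loc(S,\theta(E))$ is the unique homomorphism with $\theta_E\alpha_E=\alpha_{\theta(E)}\theta$. The map $\hat\theta:S(L(S))\to S(L(R))$ is $\hat\theta(C)=\{R_E\in L(R):S_{\theta(E)}\in C\}$; it is continuous with $\hat\theta^{-1}(\widetilde{U_E})=\widetilde{U_{\theta(E)}}$. $\hat\theta^\#:\mathcal O_{\mathrm{NCSpec}(R)}\to\hat\theta_*\mathcal O_{\mathrm{NCSpec}(S)}$ is the unique morphism of sheaves equal to $\theta_E$ on each $\widetilde{U_E}$. Prim morphisms: an open subset $U$ of a topological space is completely $\cup$-irreducible if whenever $U=\bigcup_\lambda U_\lambda$ with each $U_\lambda$ open (possibly an empty family), some $U_\lambda=U$. A morphism of ringed spaces $(\phi,\phi^\#):(X,\mathcal O_X)\to(Y,\mathcal O_Y)$ is prim if for every completely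 $\cup$-irreducible open $U\subset Y$: (1) $\phi^{-1}(U)$ is completely $\cup$-irreducible; and (2) for every completely $\cup$-irreducible open $V\subset U$, the square with rows $\mathcal O_Y(U)\to(\phi_*\mathcal O_X)(U)$ and $\mathcal O_Y(V)\to(\phi_*\mathcal O_X)(V)$ given by $\phi^\#$ and columns the restriction maps is a pushout in the category of rings. Identities are prim and prim morphisms compose. *)

(* Defs.v *)
From HB Require Import structures.
From mathcomp Require Import all_boot all_order all_algebra generic_quotient.
From mathcomp Require Import finmap.
From mathcomp Require Import boolp classical_sets topology_structure.

Set Implicit Arguments.
Unset Strict Implicit.
Unset Printing Implicit Defensive.

Import Order.TTheory GRing.Theory.
Local Open Scope quotient_scope.
Local Open Scope classical_set_scope.
Local Open Scope ring_scope.

(* [pzRingType] is the type of unital, possibly zero, possibly noncommutative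
   rings. [GRing.unit] is only available for nonzero rings. *)
Definition isunit (R : pzRingType) (x : R) : Prop :=
  exists y, x * y = 1 /\ y * x = 1.

Lemma isunit1 (R : pzRingType) : isunit (1 : R).
Proof. by exists 1; rewrite mulr1. Qed.

Lemma rmorph_isunit (R S : pzRingType) (f : {rmorphism R -> S}) x :
  isunit x -> isunit (f x).
Proof.
by move=> [y [xy yx]]; exists (f y); rewrite -!rmorphM xy yx rmorph1.
Qed.

Lemma inv_uniq (R : pzRingType) (x y z : R) : x * y = 1 -> z * x = 1 -> y = z.
Proof. by move=> xy zx; rewrite -[y]mul1r -zx -mulrA xy mulr1. Qed.

Definition mk_rmorphism (R S : pzRingType) (f : R -> S)
    (fB : zmod_morphism f) (fM : monoid_morphism f) : {rmorphism R -> S} :=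
  HB.pack f (GRing.isZmodMorphism.Build R S f fB)
            (GRing.isMonoidMorphism.Build R S f fM).

Lemma rmorphism_ext (R S : pzRingType) (f g : {rmorphism R -> S}) :
  f =1 g -> f = g.
Proof.
case: f => f [[fa0] [fm]]; case: g => g [[ga0] [gm]] /= /funext fg.
move: fa0 fm; rewrite fg => fa0 fm.
by rewrite (Prop_irrelevance fa0 ga0) (Prop_irrelevance fm gm).
Qed.

Definition is_pushout (A B C D : pzRingType) (f : {rmorphism A -> B})
    (g : {rmorphism A -> C}) (i : {rmorphism B -> D}) (j : {rmorphism C -> D}) :=
  (forall a, i (f a) = j (g a)) /\
  forall (T : pzRingType) (u : {rmorphism B -> T}) (v : {rmorphism C -> T}),
    (forall a, u (f a) = v (g a)) ->
    exists! w : {rmorphism D -> T},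
      (forall b, w (i b) = u b) /\ (forall c, w (j c) = v c).

(* [loc R A] is the ring presented by the elements and relations of [R]
   together with a formal inverse of each [a] in [A]. *)
Inductive loc_term (R : pzRingType) (A : set R) : Type :=
| LBase of R
| LInv (a : R) of A a
| LAdd of loc_term A & loc_term A
| LOpp of loc_term A
| LMul of loc_term A & loc_term A.

Arguments LBase {R} A r.
Arguments LInv {R A a} Aa.

Inductive loc_rel (R : pzRingType) (A : set R) :
    loc_term A -> loc_term A -> Prop :=
| lrel_refl x : loc_rel x x
| lrel_sym x y : loc_rel x y -> loc_rel y x
| lrel_trans x y z : loc_rel x y -> loc_rel y z -> loc_rel x z
| lrel_add x x' y y' :
    loc_rel x x' -> loc_rel y y' -> loc_rel (LAdd x y) (LAdd x' y')
| lrel_opp x x' : loc_rel x x' -> loc_rel (LOpp x) (LOpp x')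
| lrel_mul x x' y y' :
    loc_rel x x' -> loc_rel y y' -> loc_rel (LMul x y) (LMul x' y')
| lrel_addA x y z : loc_rel (LAdd x (LAdd y z)) (LAdd (LAdd x y) z)
| lrel_addC x y : loc_rel (LAdd x y) (LAdd y x)
| lrel_add0 x : loc_rel (LAdd (LBase A 0) x) x
| lrel_addN x : loc_rel (LAdd (LOpp x) x) (LBase A 0)
| lrel_mulA x y z : loc_rel (LMul x (LMul y z)) (LMul (LMul x y) z)
| lrel_mul1l x : loc_rel (LMul (LBase A 1) x) x
| lrel_mul1r x : loc_rel (LMul x (LBase A 1)) x
| lrel_mulDl x y z :
    loc_rel (LMul (LAdd x y) z) (LAdd (LMul x z) (LMul y z))
| lrel_mulDr x y z :
    loc_rel (LMul x (LAdd y z)) (LAdd (LMul x y) (LMul x z))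
| lrel_baseD r s : loc_rel (LBase A (r + s)) (LAdd (LBase A r) (LBase A s))
| lrel_baseM r s : loc_rel (LBase A (r * s)) (LMul (LBase A r) (LBase A s))
| lrel_invl a (Aa : A a) : loc_rel (LMul (LInv Aa) (LBase A a)) (LBase A 1)
| lrel_invr a (Aa : A a) : loc_rel (LMul (LBase A a) (LInv Aa)) (LBase A 1).

HB.instance Definition _ (R : pzRingType) (A : set R) :=
  gen_eqMixin (loc_term A).
HB.instance Definition _ (R : pzRingType) (A : set R) :=
  gen_choiceMixin (loc_term A).

Definition loc_relb (R : pzRingType) (A : set R) : rel (loc_term A) :=
  fun x y => `[< loc_rel x y >].

Lemma loc_relb_refl (R : pzRingType) (A : set R) : reflexive (@loc_relb R A).
Proof. by move=> x; apply/asboolP; exact: lrel_refl. Qed.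

Lemma loc_relb_sym (R : pzRingType) (A : set R) : symmetric (@loc_relb R A).
Proof. by move=> x y; apply/asboolP/asboolP; exact: lrel_sym. Qed.

Lemma loc_relb_trans (R : pzRingType) (A : set R) : transitive (@loc_relb R A).
Proof.
by move=> y x z /asboolP xy /asboolP yz; apply/asboolP; exact: lrel_trans yz.
Qed.

Canonical loc_equiv (R : pzRingType) (A : set R) :=
  EquivRel (@loc_relb R A) (@loc_relb_refl R A) (@loc_relb_sym R A)
    (@loc_relb_trans R A).

Definition loc (R : pzRingType) (A : set R) : Type := {eq_quot @loc_relb R A}.

HB.instance Definition _ (R : pzRingType) (A : set R) :=
  Choice.on (loc A).

Definition loc_pi (R : pzRingType) (A : set R) (t : loc_term A) : loc A :=
  \pi_{eq_quot @loc_relb R A} t.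

Definition loc_repr (R : pzRingType) (A : set R) (x : loc A) : loc_term A :=
  repr (x : {eq_quot @loc_relb R A}).

Lemma loc_reprK (R : pzRingType) (A : set R) :
  cancel (@loc_repr R A) (@loc_pi R A).
Proof. by move=> x; rewrite /loc_pi reprK. Qed.

Lemma loc_piP (R : pzRingType) (A : set R) (s t : loc_term A) :
  loc_pi s = loc_pi t <-> loc_rel s t.
Proof.
split => [/(eqquotP {eq_quot @loc_relb R A})/asboolP//|st].
by apply/(eqquotP {eq_quot @loc_relb R A})/asboolP.
Qed.

Lemma loc_repr_pi (R : pzRingType) (A : set R) (t : loc_term A) :
  loc_rel (loc_repr (loc_pi t)) t.
Proof. by apply/loc_piP; rewrite loc_reprK. Qed.

Definition loc_add (R : pzRingType) (A : set R) (x y : loc A) : loc A :=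
  loc_pi (LAdd (loc_repr x) (loc_repr y)).
Definition loc_opp (R : pzRingType) (A : set R) (x : loc A) : loc A :=
  loc_pi (LOpp (loc_repr x)).
Definition loc_mul (R : pzRingType) (A : set R) (x y : loc A) : loc A :=
  loc_pi (LMul (loc_repr x) (loc_repr y)).

Lemma loc_piD (R : pzRingType) (A : set R) (s t : loc_term A) :
  loc_add (loc_pi s) (loc_pi t) = loc_pi (LAdd s t).
Proof. by apply/loc_piP; apply: lrel_add; exact: loc_repr_pi. Qed.
Lemma loc_piN (R : pzRingType) (A : set R) (s : loc_term A) :
  loc_opp (loc_pi s) = loc_pi (LOpp s).
Proof. by apply/loc_piP; apply: lrel_opp; exact: loc_repr_pi. Qed.
Lemma loc_piM (R : pzRingType) (A : set R) (s t : loc_term A) :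
  loc_mul (loc_pi s) (loc_pi t) = loc_pi (LMul s t).
Proof. by apply/loc_piP; apply: lrel_mul; exact: loc_repr_pi. Qed.

Lemma loc_addA (R : pzRingType) (A : set R) : associative (@loc_add R A).
Proof.
move=> x y z; rewrite -(loc_reprK x) -(loc_reprK y) -(loc_reprK z) !loc_piD.
exact/loc_piP/lrel_addA.
Qed.
Lemma loc_addC (R : pzRingType) (A : set R) : commutative (@loc_add R A).
Proof.
move=> x y; rewrite -(loc_reprK x) -(loc_reprK y) !loc_piD.
exact/loc_piP/lrel_addC.
Qed.
Lemma loc_add0 (R : pzRingType) (A : set R) :
  left_id (loc_pi (LBase A 0)) (@loc_add R A).
Proof.
by move=> x; rewrite -(loc_reprK x) loc_piD; exact/loc_piP/lrel_add0.
Qed.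
Lemma loc_addN (R : pzRingType) (A : set R) :
  left_inverse (loc_pi (LBase A 0)) (@loc_opp R A) (@loc_add R A).
Proof.
by move=> x; rewrite -(loc_reprK x) loc_piN loc_piD; exact/loc_piP/lrel_addN.
Qed.
Lemma loc_mulA (R : pzRingType) (A : set R) : associative (@loc_mul R A).
Proof.
move=> x y z; rewrite -(loc_reprK x) -(loc_reprK y) -(loc_reprK z) !loc_piM.
exact/loc_piP/lrel_mulA.
Qed.
Lemma loc_mul1l (R : pzRingType) (A : set R) :
  left_id (loc_pi (LBase A 1)) (@loc_mul R A).
Proof.
by move=> x; rewrite -(loc_reprK x) loc_piM; exact/loc_piP/lrel_mul1l.
Qed.
Lemma loc_mul1r (R : pzRingType) (A : set R) :
  right_id (loc_pi (LBase A 1)) (@loc_mul R A).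
Proof.
by move=> x; rewrite -(loc_reprK x) loc_piM; exact/loc_piP/lrel_mul1r.
Qed.
Lemma loc_mulDl (R : pzRingType) (A : set R) :
  left_distributive (@loc_mul R A) (@loc_add R A).
Proof.
move=> x y z; rewrite -(loc_reprK x) -(loc_reprK y) -(loc_reprK z).
set s := loc_repr x; set t := loc_repr y; set u := loc_repr z.
rewrite (loc_piD s t) (loc_piM _ u) (loc_piM s u) (loc_piM t u) loc_piD.
exact/loc_piP/lrel_mulDl.
Qed.
Lemma loc_mulDr (R : pzRingType) (A : set R) :
  right_distributive (@loc_mul R A) (@loc_add R A).
Proof.
move=> x y z; rewrite -(loc_reprK x) -(loc_reprK y) -(loc_reprK z).
set s := loc_repr x; set t := loc_repr y; set u := loc_repr z.
rewrite (loc_piD t u) (loc_piM s _) (loc_piM s t) (loc_piM s u) loc_piD.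
exact/loc_piP/lrel_mulDr.
Qed.

HB.instance Definition _ (R : pzRingType) (A : set R) :=
  GRing.isPzRing.Build (loc A) (@loc_addA R A) (@loc_addC R A) (@loc_add0 R A)
    (@loc_addN R A) (@loc_mulA R A) (@loc_mul1l R A) (@loc_mul1r R A)
    (@loc_mulDl R A) (@loc_mulDr R A).

Lemma loc_addE (R : pzRingType) (A : set R) (s t : loc_term A) :
  loc_pi (LAdd s t) = loc_pi s + loc_pi t.
Proof. by rewrite -loc_piD. Qed.
Lemma loc_oppE (R : pzRingType) (A : set R) (s : loc_term A) :
  loc_pi (LOpp s) = - loc_pi s.
Proof. by rewrite -loc_piN. Qed.
Lemma loc_mulE (R : pzRingType) (A : set R) (s t : loc_term A) :
  loc_pi (LMul s t) = loc_pi s * loc_pi t.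
Proof. by rewrite -loc_piM. Qed.

Lemma loc_alpha_zmod (R : pzRingType) (A : set R) :
  zmod_morphism (fun r => loc_pi (LBase A r)).
Proof.
move=> r s; apply/eqP; rewrite eq_sym subr_eq; apply/eqP.
rewrite -loc_addE; apply/loc_piP.
by have := lrel_baseD A (r - s) s; rewrite subrK.
Qed.

Lemma loc_alpha_monoid (R : pzRingType) (A : set R) :
  monoid_morphism (fun r => loc_pi (LBase A r)).
Proof.
by split=> // r s; rewrite -loc_mulE; exact/loc_piP/lrel_baseM.
Qed.

Definition alpha (R : pzRingType) (A : set R) : {rmorphism R -> loc A} :=
  mk_rmorphism (@loc_alpha_zmod R A) (@loc_alpha_monoid R A).

Lemma alpha_unit (R : pzRingType) (A : set R) (a : R) :
  A a -> isunit (alpha A a).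
Proof.
move=> Aa; exists (loc_pi (LInv Aa)); split.
  by rewrite -loc_mulE; exact/loc_piP/lrel_invr.
by rewrite -loc_mulE; exact/loc_piP/lrel_invl.
Qed.

Fixpoint loc_eval (R T : pzRingType) (A : set R) (f : {rmorphism R -> T})
    (fA : forall a, A a -> isunit (f a)) (t : loc_term A) : T :=
  match t with
  | LBase r => f r
  | LInv a Aa => sval (cid (fA a Aa))
  | LAdd x y => loc_eval fA x + loc_eval fA y
  | LOpp x => - loc_eval fA x
  | LMul x y => loc_eval fA x * loc_eval fA y
  end.

Lemma loc_eval_rel (R T : pzRingType) (A : set R) (f : {rmorphism R -> T})
    (fA : forall a, A a -> isunit (f a)) (s t : loc_term A) :
  loc_rel s t -> loc_eval fA s = loc_eval fA t.
Proof.
elim=> {s t} //=.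
- by move=> x y z _ -> _ ->.
- by move=> x x' y y' _ -> _ ->.
- by move=> x x' _ ->.
- by move=> x x' y y' _ -> _ ->.
- by move=> x y z; rewrite addrA.
- by move=> x y; rewrite addrC.
- by move=> x; rewrite rmorph0 add0r.
- by move=> x; rewrite rmorph0 addNr.
- by move=> x y z; rewrite mulrA.
- by move=> x; rewrite rmorph1 mul1r.
- by move=> x; rewrite rmorph1 mulr1.
- by move=> x y z; rewrite mulrDl.
- by move=> x y z; rewrite mulrDr.
- by move=> r s; rewrite rmorphD.
- by move=> r s; rewrite rmorphM.
- by move=> a Aa; case: cid => y [_ /= ->]; rewrite rmorph1.
- by move=> a Aa; case: cid => y [/= -> _]; rewrite rmorph1.
Qed.

Lemma loc_eval_pi (R T : pzRingType) (A : set R) (f : {rmorphism R -> T})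
    (fA : forall a, A a -> isunit (f a)) (t : loc_term A) :
  loc_eval fA (loc_repr (loc_pi t)) = loc_eval fA t.
Proof. exact/loc_eval_rel/loc_repr_pi. Qed.

Lemma loc_lift_zmod (R T : pzRingType) (A : set R) (f : {rmorphism R -> T})
    (fA : forall a, A a -> isunit (f a)) :
  zmod_morphism (fun x : loc A => loc_eval fA (loc_repr x)).
Proof.
move=> x y; rewrite -(loc_reprK x) -(loc_reprK y).
set s := loc_repr x; set t := loc_repr y.
by rewrite -loc_oppE -loc_addE !loc_eval_pi.
Qed.

Lemma loc_lift_monoid (R T : pzRingType) (A : set R) (f : {rmorphism R -> T})
    (fA : forall a, A a -> isunit (f a)) :
  monoid_morphism (fun x : loc A => loc_eval fA (loc_repr x)).
Proof.
split=> [|x y]; first by apply: (etrans (loc_eval_pi _ _)) => /=; rewrite rmorph1.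
by rewrite -(loc_reprK x) -(loc_reprK y) -loc_mulE !loc_eval_pi.
Qed.

Definition loc_lift (R T : pzRingType) (A : set R) (f : {rmorphism R -> T})
    (fA : forall a, A a -> isunit (f a)) : {rmorphism loc A -> T} :=
  mk_rmorphism (loc_lift_zmod fA) (loc_lift_monoid fA).

Lemma loc_liftE (R T : pzRingType) (A : set R) (f : {rmorphism R -> T})
    (fA : forall a, A a -> isunit (f a)) (r : R) :
  loc_lift fA (alpha A r) = f r.
Proof. exact: loc_eval_pi. Qed.

Lemma loc_hom_ext (R T : pzRingType) (A : set R)
    (g h : {rmorphism loc A -> T}) :
  (forall r, g (alpha A r) = h (alpha A r)) -> g =1 h.
Proof.
move=> gh x; rewrite -(loc_reprK x); elim: (loc_repr x) => {x}.
- exact: gh.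
- move=> a Aa; apply: (@inv_uniq _ (g (alpha A a))).
    rewrite -rmorphM -(rmorph1 g); congr (g _).
    by rewrite -loc_mulE; exact/loc_piP/lrel_invr.
  rewrite gh -rmorphM -(rmorph1 h); congr (h _).
  by rewrite -loc_mulE; exact/loc_piP/lrel_invl.
- by move=> s IHs t IHt; rewrite loc_addE !rmorphD IHs IHt.
- by move=> s IHs; rewrite loc_oppE !rmorphN IHs.
- by move=> s IHs t IHt; rewrite loc_mulE !rmorphM IHs IHt.
Qed.

Theorem loc_universal (R T : pzRingType) (A : set R) (f : {rmorphism R -> T}) :
  (forall a, A a -> isunit (f a)) ->
  exists! g : {rmorphism loc A -> T}, forall r, g (alpha A r) = f r.
Proof.
move=> fA; exists (loc_lift fA); split=> [r|h hE]; first exact: loc_liftE.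
by apply/rmorphism_ext/loc_hom_ext => r; rewrite hE; exact: loc_liftE.
Qed.

Record opens (X : topologicalType) :=
  Opens { opens_set :> set X; opens_open : open opens_set }.

Definition opensI (X : topologicalType) (U V : opens X) : opens X :=
  Opens (openI (opens_open U) (opens_open V)).

Definition opens_preim (X Y : topologicalType) (f : X -> Y)
    (fc : continuous f) (U : opens Y) : opens X :=
  Opens (proj1 (continuousP f) fc U (opens_open U)).

Lemma opensIl (X : topologicalType) (U V : opens X) : opensI U V `<=` U.
Proof. by move=> x []. Qed.

Lemma opensIr (X : topologicalType) (U V : opens X) : opensI U V `<=` V.
Proof. by move=> x []. Qed.

Definition opens_preimS (X Y : topologicalType) (f : X -> Y)
    (fc : continuous f) (U V : opens Y) (VU : V `<=` U) :
    opens_preim fc V `<=` opens_preim fc U := fun x => VU (f x).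

Arguments opens_preimS {X Y f} fc {U V}.

Lemma opens_ext (X : topologicalType) (U V : opens X) :
  U = V :> set X -> U = V.
Proof.
case: U V => [U oU] [V oV] /= UV; move: oU; rewrite UV => oU.
by rewrite (Prop_irrelevance oU oV).
Qed.

Record ring_sheaf (X : topologicalType) := RingSheaf {
  sections :> opens X -> pzRingType;
  res : forall U V : opens X, V `<=` U -> {rmorphism sections U -> sections V};
  res_id : forall (U : opens X) (UU : U `<=` U) s, res UU s = s;
  res_comp : forall (U V W : opens X) (VU : V `<=` U) (WV : W `<=` V)
    (WU : W `<=` U) s, res WV (res VU s) = res WU s;
  sheaf_glue : forall (I : Type) (Ui : I -> opens X) (U : opens X)
      (s : forall i, sections (Ui i)),
    U = \bigcup_i Ui i :> set X ->
    (forall i j, res (@opensIl _ (Ui i) (Ui j)) (s i) =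
                 res (@opensIr _ (Ui i) (Ui j)) (s j)) ->
    exists! t : sections U, forall i (UiU : Ui i `<=` U), res UiU t = s i
}.

Arguments res {X} r {U V}.

Lemma res_trans (X : topologicalType) (F : ring_sheaf X) (U V W : opens X)
    (VU : V `<=` U) (WV : W `<=` V) s :
  res F WV (res F VU s) = res F (subset_trans WV VU) s.
Proof. exact: res_comp. Qed.

Lemma res_irr (X : topologicalType) (F : ring_sheaf X) (U V : opens X)
    (VU VU' : V `<=` U) s : res F VU s = res F VU' s.
Proof. by rewrite (Prop_irrelevance VU VU'). Qed.

Record ringed_space := RingedSpace {
  rs_space :> topologicalType;
  rs_sheaf : ring_sheaf rs_space
}.

Record rs_hom (X Y : ringed_space) := RSHom {
  rs_map :> X -> Y;
  rs_cont : continuous rs_map;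
  rs_comap : forall U : opens Y,
    {rmorphism rs_sheaf Y U -> rs_sheaf X (opens_preim rs_cont U)};
  rs_natural : forall (U V : opens Y) (VU : V `<=` U) s,
    rs_comap V (res (rs_sheaf Y) VU s) =
    res (rs_sheaf X) (opens_preimS rs_cont VU)
      (rs_comap U s)
}.

Arguments rs_cont {X Y} r.
Arguments rs_comap {X Y} r U.

Lemma rs_hom_ext (X Y : ringed_space) (f g : rs_hom X Y) :
  f =1 g ->
  (forall (U : opens Y) (h : opens_preim (rs_cont g) U `<=`
       opens_preim (rs_cont f) U) s,
     res (rs_sheaf X) h (rs_comap f U s) = rs_comap g U s) ->
  f = g.
Proof.
case: f => f fc fm fn; case: g => g gc gm gn /= /funext fg.
subst g; move: gm gn; rewrite -(Prop_irrelevance fc gc) => gm gn h.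
have E : fm = gm.
  apply: functional_extensionality_dep => U; apply: rmorphism_ext => s.
  by rewrite -(h U (@subset_refl _ _)) res_id.
by move: fn gn; rewrite E => fn gn; rewrite (Prop_irrelevance fn gn).
Qed.

Lemma continuous_idfun (X : topologicalType) : continuous (@idfun X).
Proof. by move=> x; exact: cvg_id. Qed.

Lemma continuous_compfun (X Y Z : topologicalType) (f : X -> Y) (g : Y -> Z) :
  continuous f -> continuous g -> continuous (g \o f).
Proof. by move=> fc gc x; apply: continuous_comp; [exact: fc|exact: gc]. Qed.

Lemma opens_preim_id (X : topologicalType) (U : opens X) :
  opens_preim (@continuous_idfun X) U `<=` U.
Proof. by []. Qed.

Lemma opens_preim_comp (X Y Z : topologicalType) (f : X -> Y) (g : Y -> Z)
    (fc : continuous f) (gc : continuous g) (U : opens Z) :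
  opens_preim (continuous_compfun fc gc) U `<=`
    opens_preim fc (opens_preim gc U).
Proof. by []. Qed.

Arguments opens_preim_id {X} U.
Arguments opens_preim_comp {X Y Z f g} fc gc U.

(* In [rs_id] and [rs_comp] the restriction maps go between open sets that
   have the same points; they only identify two proofs of openness. *)
Lemma rs_id_natural (X : ringed_space) (U V : opens X) (VU : V `<=` U) s :
  res (rs_sheaf X) (opens_preim_id V) (res (rs_sheaf X) VU s) =
  res (rs_sheaf X) (opens_preimS (@continuous_idfun X) VU)
    (res (rs_sheaf X) (opens_preim_id U) s).
Proof.
by rewrite !res_trans; exact: res_irr.
Qed.

Definition rs_id (X : ringed_space) : rs_hom X X :=
  @RSHom X X idfun (@continuous_idfun X)
    (fun U => res (rs_sheaf X) (opens_preim_id U))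
    (@rs_id_natural X).

Definition rs_comp_comap (X Y Z : ringed_space) (g : rs_hom Y Z)
    (f : rs_hom X Y) (U : opens Z) :
    {rmorphism rs_sheaf Z U ->
       rs_sheaf X (opens_preim (continuous_compfun (rs_cont f) (rs_cont g)) U)} :=
  res (rs_sheaf X) (opens_preim_comp (rs_cont f) (rs_cont g) U) \o
    (rs_comap f (opens_preim (rs_cont g) U) \o rs_comap g U).

Lemma rs_comp_natural (X Y Z : ringed_space) (g : rs_hom Y Z) (f : rs_hom X Y)
    (U V : opens Z) (VU : V `<=` U) s :
  rs_comp_comap g f V (res (rs_sheaf Z) VU s) =
  res (rs_sheaf X) (opens_preimS (continuous_compfun (rs_cont f) (rs_cont g)) VU)
    (rs_comp_comap g f U s).
Proof.
by rewrite /rs_comp_comap /= !rs_natural !res_trans; exact: res_irr.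
Qed.

Definition rs_comp (X Y Z : ringed_space) (g : rs_hom Y Z) (f : rs_hom X Y) :
    rs_hom X Z :=
  @RSHom X Z (g \o f) (continuous_compfun (rs_cont f) (rs_cont g))
    (rs_comp_comap g f) (@rs_comp_natural X Y Z g f).

Definition cup_irreducible (X : topologicalType) (U : set X) : Prop :=
  open U /\
  forall F : set (set X), (forall V, F V -> open V) ->
    U = \bigcup_(V in F) V -> F U.

Definition prim (X Y : ringed_space) (f : rs_hom X Y) : Prop :=
  forall U : opens Y, cup_irreducible U ->
    cup_irreducible (opens_preim (rs_cont f) U) /\
    forall (V : opens Y) (VU : V `<=` U), cup_irreducible V ->
      is_pushout (rs_comap f U) (res (rs_sheaf Y) VU)
        (res (rs_sheaf X) (opens_preimS (rs_cont f) VU)) (rs_comap f V).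

Lemma rs_comp_id (X Y : ringed_space) (f : rs_hom X Y) :
  rs_comp f (rs_id X) = f.
Proof.
apply: rs_hom_ext => // U h s /=.
by rewrite !res_trans res_id.
Qed.

Lemma rs_id_comp (X Y : ringed_space) (f : rs_hom X Y) :
  rs_comp (rs_id Y) f = f.
Proof.
apply: rs_hom_ext => // U h s /=.
by rewrite rs_natural !res_trans res_id.
Qed.

Lemma rs_compA (W X Y Z : ringed_space) (h : rs_hom Y Z) (g : rs_hom X Y)
    (f : rs_hom W X) : rs_comp h (rs_comp g f) = rs_comp (rs_comp h g) f.
Proof.
apply: rs_hom_ext => // U hU s /=.
by rewrite rs_natural !res_trans; exact: res_irr.
Qed.

Lemma is_pushout_idem (A B C D : pzRingType) (f : {rmorphism A -> B})
    (g : {rmorphism A -> C}) (i : {rmorphism B -> D}) (j : {rmorphism C -> D})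
    (f' : {rmorphism B -> A}) (j' : {rmorphism D -> C}) :
  cancel f f' -> cancel f' f -> cancel j j' -> cancel j' j ->
  (forall a, i (f a) = j (g a)) -> is_pushout f g i j.
Proof.
move=> fK f'K jK j'K sq; split=> // T u v uv.
exists (v \o j'); split=> [|w [wi wj]].
  split=> [b|c] /=; last by rewrite jK.
  by rewrite -{1}(f'K b) sq jK -uv f'K.
by apply: rmorphism_ext => d /=; rewrite -wj j'K.
Qed.

Lemma prim_id (X : ringed_space) : prim (rs_id X).
Proof.
move=> U Uirr; split=> [//|V VU Virr].
have E (W : opens X) : W `<=` opens_preim (@continuous_idfun X) W by [].
apply: (@is_pushout_idem _ _ _ _ _ _ _ _ (res (rs_sheaf X) (E U))
  (res (rs_sheaf X) (E V))) => s /=;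
  rewrite ?(res_comp _ _ (@subset_refl _ _)) ?res_id //.
exact/esym/(rs_id_natural VU).
Qed.

Lemma is_pushout_paste (A B C D B' D' : pzRingType) (f : {rmorphism A -> B})
    (g : {rmorphism A -> C}) (i : {rmorphism B -> D}) (j : {rmorphism C -> D})
    (f' : {rmorphism B -> B'}) (i' : {rmorphism B' -> D'})
    (j' : {rmorphism D -> D'}) :
  is_pushout f g i j -> is_pushout f' i i' j' ->
  is_pushout (f' \o f) g i' (j' \o j).
Proof.
move=> [sq univ] [sq' univ']; split=> [a /=|T u v uv]; first by rewrite sq' sq.
have [w [[wi wj] wuniq]] := univ T (u \o f') v uv.
have [w' [[wi' wj'] wuniq']] := univ' T u w (fun b => esym (wi b)).
exists w'; split=> [|z [zi zj]].
  by split=> // c /=; rewrite wj' wj.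
apply: wuniq'; split=> // d.
suff -> : w = z \o j' by [].
apply: wuniq; split=> [b|c] /=; last exact: zj.
by rewrite -sq' zi.
Qed.

Lemma prim_comp (X Y Z : ringed_space) (g : rs_hom Y Z) (f : rs_hom X Y) :
  prim g -> prim f -> prim (rs_comp g f).
Proof.
move=> pg pf U Uirr; have [gU gsq] := pg _ Uirr; have [fU fsq] := pf _ gU.
split=> [//|V VU Virr]; have [gV _] := pg _ Virr.
apply: is_pushout_paste
  (is_pushout_paste (gsq _ VU Virr) (fsq _ (opens_preimS _ VU) gV)) _.
have E W : opens_preim (rs_cont f) (opens_preim (rs_cont g) W) `<=`
  opens_preim (continuous_compfun (rs_cont f) (rs_cont g)) W by [].
by apply: (@is_pushout_idem _ _ _ _ _ _ _ _ (res (rs_sheaf X) (E U))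
  (res (rs_sheaf X) (E V))) => s; rewrite !res_trans ?res_id //; exact: res_irr.
Qed.

Lemma direct_image_glue (X Y : topologicalType) (f : X -> Y)
    (fc : continuous f) (F : ring_sheaf X) (I : Type) (Ui : I -> opens Y)
    (U : opens Y) (s : forall i, F (opens_preim fc (Ui i))) :
  U = \bigcup_i Ui i :> set Y ->
  (forall i j, res F (opens_preimS fc (@opensIl _ (Ui i) (Ui j))) (s i) =
               res F (opens_preimS fc (@opensIr _ (Ui i) (Ui j))) (s j)) ->
  exists! t : F (opens_preim fc U),
    forall i (UiU : Ui i `<=` U), res F (opens_preimS fc UiU) t = s i.
Proof.
move=> UE scomp.
have UE' : opens_preim fc U = \bigcup_i opens_preim fc (Ui i) :> set X.
  by rewrite /= UE preimage_bigcup.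
have [|t [tE tuniq]] := sheaf_glue (r := F) (s := s) UE'.
  move=> i j.
  have E : opensI (opens_preim fc (Ui i)) (opens_preim fc (Ui j)) `<=`
    opens_preim fc (opensI (Ui i) (Ui j)) by [].
  have := congr1 (res F E) (scomp i j); rewrite !res_trans => E'.
  by apply: etrans (etrans E' _); exact: res_irr.
exists t; split=> [i UiU|t' t'E]; first exact: tE.
apply: tuniq => i UiU.
have UiU' : Ui i `<=` U by rewrite UE => x; exists i.
by rewrite -(t'E i UiU'); exact: res_irr.
Qed.

Definition direct_image (X Y : topologicalType) (f : X -> Y)
    (fc : continuous f) (F : ring_sheaf X) : ring_sheaf Y :=
  @RingSheaf Y (fun U => F (opens_preim fc U))
    (fun U V VU => res F (opens_preimS fc VU))
    (fun U UU s => res_id (opens_preimS fc UU) s)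
    (fun U V W VU WV WU s => res_comp (opens_preimS fc VU)
       (opens_preimS fc WV) (opens_preimS fc WU) s)
    (@direct_image_glue X Y f fc F).

Definition irreducible_closed (X : topologicalType) (C : set X) : Prop :=
  [/\ closed C, C !=set0 &
      forall A B : set X, closed A -> closed B -> C `<=` A `|` B ->
        C `<=` A \/ C `<=` B].

Record sober (X : topologicalType) :=
  Sober { sober_set :> set X; sober_irr : irreducible_closed sober_set }.

HB.instance Definition _ (X : topologicalType) := gen_eqMixin (sober X).
HB.instance Definition _ (X : topologicalType) := gen_choiceMixin (sober X).

Lemma sober_ext (X : topologicalType) (C D : sober X) :
  C = D :> set X -> C = D.
Proof.
case: C D => [C iC] [D iD] /= CD; move: iC; rewrite CD => iC.
by rewrite (Prop_irrelevance iC iD).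
Qed.

Definition tilde (X : topologicalType) (U : set X) : set (sober X) :=
  [set C | C `&` U !=set0].

Definition sober_open (X : topologicalType) : set_system (sober X) :=
  [set W | exists2 U : set X, open U & W = tilde U].

Lemma sober_openT (X : topologicalType) : sober_open (@setT (sober X)).
Proof.
exists setT; first exact: openT.
apply/seteqP; split=> C // _; rewrite /tilde /= setIT.
by case: (sober_irr C).
Qed.

Lemma tildeI (X : topologicalType) (U V : set X) : open U -> open V ->
  tilde (U `&` V) = tilde U `&` tilde V.
Proof.
move=> oU oV; apply/seteqP; split=> C /=.
  by move=> [x [Cx [Ux Vx]]]; split; exists x.
move=> [[x [Cx Ux]] [y [Cy Vy]]]; have [_ _ irr] := sober_irr C.
apply: contrapT => nUV.
have : C `<=` ~` U `|` ~` V.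
  move=> z Cz; rewrite -setCI => UVz; apply: nUV; by exists z.
case/(irr _ _ (open_closedC oU) (open_closedC oV)).
  by move/(_ _ Cx).
by move/(_ _ Cy).
Qed.

Lemma sober_openI (X : topologicalType) : setI_closed (@sober_open X).
Proof.
move=> _ _ [U oU ->] [V oV ->]; exists (U `&` V); first exact: openI.
by rewrite tildeI.
Qed.

Lemma tilde_bigcup (X : topologicalType) (I : Type) (f : I -> set X) :
  tilde (\bigcup_i f i) = \bigcup_i tilde (f i).
Proof.
apply/seteqP; split=> C.
  by move=> [x [Cx [i _ fx]]]; exists i => //; exists x.
by move=> [i _ [x [Cx fx]]]; exists x; split=> //; exists i.
Qed.

Lemma sober_open_bigU (X : topologicalType) (I : Type) (f : I -> set (sober X)) :
  (forall i, sober_open (f i)) -> sober_open (\bigcup_i f i).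
Proof.
move=> fo; exists (\bigcup_i projT1 (cid2 (fo i))).
  by apply: bigcup_open => i _; case: cid2.
by rewrite tilde_bigcup; apply: eq_bigcupr => i _; case: cid2.
Qed.

HB.instance Definition _ (X : topologicalType) :=
  isOpenTopological.Build (sober X) (@sober_openT X) (@sober_openI X)
    (@sober_open_bigU X).

Lemma sober_openE (X : topologicalType) (W : set (sober X)) :
  open W <-> exists2 U : set X, open U & W = tilde U.
Proof. by []. Qed.

Lemma closure1_irreducible (X : topologicalType) (x : X) :
  irreducible_closed (closure [set x]).
Proof.
split; first exact: closed_closure.
  by exists x; apply: subset_closure.
move=> A B cA cB AB.
have [Ax|Bx] : (A `|` B) x by apply: AB; exact: subset_closure.
  left; rewrite (proj1 (closure_id A) cA); apply: closureS => _ -> //.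
by right; rewrite (proj1 (closure_id B) cB); apply: closureS => _ ->.
Qed.

Definition sober_pt (X : topologicalType) (x : X) : sober X :=
  Sober (closure1_irreducible x).

Lemma sober_pt_tilde (X : topologicalType) (U : set X) :
  open U -> @sober_pt X @^-1` tilde U = U.
Proof.
move=> oU; apply/seteqP; split=> x /=.
  move=> [y [clxy Uy]]; have [z [/= -> //]] := clxy U (open_nbhs_nbhs (conj oU Uy)).
by move=> Ux; exists x; split=> //; exact: subset_closure.
Qed.

Lemma continuous_sober_pt (X : topologicalType) : continuous (@sober_pt X).
Proof. by apply/continuousP => _ [U oU ->]; rewrite sober_pt_tilde. Qed.

(* By [sober_pt_tilde], [W |-> sober_pt @^-1` W] is the inverse of the lattice
   isomorphism [tilde] on open sets; hence the sections over [tilde U] of the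
   direct image sheaf are the sections over [U]. *)
Definition soberification (X : ringed_space) : ringed_space :=
  RingedSpace (direct_image (@continuous_sober_pt X) (rs_sheaf X)).

Record category := Category {
  cat_ob :> Type;
  cat_hom : cat_ob -> cat_ob -> Type;
  cat_id : forall a, cat_hom a a;
  cat_comp : forall a b c, cat_hom b c -> cat_hom a b -> cat_hom a c;
  cat_comp_id : forall a b (f : cat_hom a b), cat_comp f (cat_id a) = f;
  cat_id_comp : forall a b (f : cat_hom a b), cat_comp (cat_id b) f = f;
  cat_compA : forall a b c d (h : cat_hom c d) (g : cat_hom b c)
    (f : cat_hom a b), cat_comp h (cat_comp g f) = cat_comp (cat_comp h g) f
}.

Arguments cat_hom {_}.
Arguments cat_id {_}.
Arguments cat_comp {_ _ _ _}.

Definition opposite (C : category) : category :=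
  @Category C (fun a b => cat_hom b a) (fun a => cat_id a)
    (fun a b c g f => cat_comp f g)
    (fun a b f => cat_id_comp f) (fun a b f => cat_comp_id f)
    (fun a b c d h g f => esym (cat_compA f g h)).

Definition is_functor (C D : category) (F0 : C -> D)
    (F1 : forall a b, cat_hom a b -> cat_hom (F0 a) (F0 b)) : Prop :=
  (forall a, F1 a a (cat_id a) = cat_id (F0 a)) /\
  (forall a b c (g : cat_hom b c) (f : cat_hom a b),
     F1 a c (cat_comp g f) = cat_comp (F1 b c g) (F1 a b f)).

Definition fully_faithful (C D : category) (F0 : C -> D)
    (F1 : forall a b, cat_hom a b -> cat_hom (F0 a) (F0 b)) : Prop :=
  forall a b, bijective (F1 a b).

Definition isomorphic (C : category) (a b : C) : Prop :=
  exists (f : cat_hom a b) (g : cat_hom b a),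
    cat_comp g f = cat_id a /\ cat_comp f g = cat_id b.

(* Injectivity on objects is up to isomorphism. *)
Definition is_full_embedding (C D : category) (F0 : C -> D)
    (F1 : forall a b, cat_hom a b -> cat_hom (F0 a) (F0 b)) : Prop :=
  [/\ is_functor F1, fully_faithful F1 &
      forall a b, isomorphic (F0 a) (F0 b) -> isomorphic a b].

Definition rings : category.
Proof.
refine (@Category pzRingType (fun R S => {rmorphism R -> S})
  (fun R => idfun) (fun R S T g f => g \o f) _ _ _).
- by move=> R S f; apply: rmorphism_ext.
- by move=> R S f; apply: rmorphism_ext.
- by move=> R S T U h g f; apply: rmorphism_ext.
Defined.

Definition prim_hom (X Y : ringed_space) := {f : rs_hom X Y | prim f}.

Definition prim_hom_id (X : ringed_space) : prim_hom X X :=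
  exist _ (rs_id X) (@prim_id X).

Definition prim_hom_comp (X Y Z : ringed_space) (g : prim_hom Y Z)
    (f : prim_hom X Y) : prim_hom X Z :=
  exist _ (rs_comp (sval g) (sval f)) (@prim_comp _ _ _ _ _ (svalP g) (svalP f)).

Lemma prim_hom_ext (X Y : ringed_space) (f g : prim_hom X Y) :
  sval f = sval g -> f = g.
Proof.
case: f g => [f pf] [g pg] /= fg; move: pf; rewrite fg => pf.
by rewrite (Prop_irrelevance pf pg).
Qed.

Definition prim_ringed_spaces : category.
Proof.
refine (@Category ringed_space prim_hom prim_hom_id prim_hom_comp _ _ _).
- by move=> X Y f; apply: prim_hom_ext; exact: rs_comp_id.
- by move=> X Y f; apply: prim_hom_ext; exact: rs_id_comp.
- by move=> W X Y Z h g f; apply: prim_hom_ext; exact: rs_compA.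
Defined.

Definition loc_le (R : pzRingType) (A B : set R) : Prop :=
  forall a, A a -> isunit (alpha B a).

Definition loc_map (R : pzRingType) (A B : set R) (AB : loc_le A B) :
  {rmorphism loc A -> loc B} := loc_lift AB.

Lemma loc_map_alpha (R : pzRingType) (A B : set R) (AB : loc_le A B) r :
  loc_map AB (alpha A r) = alpha B r.
Proof. exact: loc_liftE. Qed.

Lemma loc_le_subset (R : pzRingType) (A B : set R) : A `<=` B -> loc_le A B.
Proof. by move=> AB a /AB; exact: alpha_unit. Qed.

Lemma loc_le_refl (R : pzRingType) (A : set R) : loc_le A A.
Proof. exact: loc_le_subset. Qed.

Lemma loc_le_trans (R : pzRingType) (A B C : set R) :
  loc_le A B -> loc_le B C -> loc_le A C.
Proof.
by move=> AB BC a /AB; rewrite -(loc_map_alpha BC); exact: rmorph_isunit.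
Qed.

Lemma loc_map_id (R : pzRingType) (A : set R) (AA : loc_le A A) x :
  loc_map AA x = x.
Proof.
apply: (loc_hom_ext (g := loc_map AA) (h := idfun)) => r.
exact: loc_map_alpha.
Qed.

Lemma loc_map_comp (R : pzRingType) (A B C : set R) (AB : loc_le A B)
    (BC : loc_le B C) (AC : loc_le A C) x :
  loc_map BC (loc_map AB x) = loc_map AC x.
Proof.
apply: (loc_hom_ext (g := loc_map BC \o loc_map AB) (h := loc_map AC)) => r.
rewrite -[LHS]/(loc_map BC (loc_map AB (alpha A r))).
by rewrite !loc_map_alpha.
Qed.

Definition loc_sim (R : pzRingType) : rel {fset R} :=
  fun E F => `[< loc_le [set` E] [set` F] /\ loc_le [set` F] [set` E] >].

Lemma loc_sim_refl (R : pzRingType) : reflexive (@loc_sim R).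
Proof. by move=> E; apply/asboolP; split; exact: loc_le_refl. Qed.

Lemma loc_sim_sym (R : pzRingType) : symmetric (@loc_sim R).
Proof. by move=> E F; apply/asboolP/asboolP => -[]. Qed.

Lemma loc_sim_trans (R : pzRingType) : transitive (@loc_sim R).
Proof.
move=> F E G /asboolP[EF FE] /asboolP[FG GF]; apply/asboolP.
by split; [exact: loc_le_trans FG|exact: loc_le_trans FE].
Qed.

Canonical loc_sim_equiv (R : pzRingType) :=
  EquivRel (@loc_sim R) (@loc_sim_refl R) (@loc_sim_sym R) (@loc_sim_trans R).

Definition locposet (R : pzRingType) : Type := {eq_quot @loc_sim R}.

HB.instance Definition _ (R : pzRingType) := Choice.on (locposet R).

Definition loc_class (R : pzRingType) (E : {fset R}) : locposet R :=
  \pi_{eq_quot @loc_sim R} E.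

Definition loc_class_repr (R : pzRingType) (x : locposet R) : {fset R} :=
  repr (x : {eq_quot @loc_sim R}).

Lemma loc_class_reprK (R : pzRingType) :
  cancel (@loc_class_repr R) (@loc_class R).
Proof. by move=> x; rewrite /loc_class reprK. Qed.

Lemma loc_classP (R : pzRingType) (E F : {fset R}) :
  loc_class E = loc_class F <->
  loc_le [set` E] [set` F] /\ loc_le [set` F] [set` E].
Proof.
split => [/(eqquotP {eq_quot @loc_sim R})/asboolP//|EF].
by apply/(eqquotP {eq_quot @loc_sim R})/asboolP.
Qed.

Definition locposet_le (R : pzRingType) : rel (locposet R) :=
  fun x y => `[< loc_le [set` loc_class_repr x] [set` loc_class_repr y] >].

Lemma locposet_le_refl (R : pzRingType) : reflexive (@locposet_le R).
Proof. by move=> x; apply/asboolP/loc_le_refl. Qed.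

Lemma locposet_le_anti (R : pzRingType) : antisymmetric (@locposet_le R).
Proof.
move=> x y /andP[/asboolP xy /asboolP yx].
rewrite -(loc_class_reprK x) -(loc_class_reprK y).
exact/loc_classP.
Qed.

Lemma locposet_le_trans (R : pzRingType) : transitive (@locposet_le R).
Proof.
move=> y x z /asboolP xy /asboolP yz; apply/asboolP; exact: loc_le_trans yz.
Qed.

Fact locposet_display : Order.disp_t. Proof. exact: Order.Disp tt tt. Qed.

HB.instance Definition _ (R : pzRingType) :=
  Order.Le_isPOrder.Build locposet_display (locposet R)
    (@locposet_le_refl R) (@locposet_le_anti R) (@locposet_le_trans R).

Lemma loc_class_leP (R : pzRingType) (E F : {fset R}) :
  (loc_class E <= loc_class F)%O <-> loc_le [set` E] [set` F].
Proof.
have [EE' E'E] := proj1 (loc_classP _ _) (loc_class_reprK (loc_class E)).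
have [FF' F'F] := proj1 (loc_classP _ _) (loc_class_reprK (loc_class F)).
split=> [/asboolP EF|EF]; last apply/asboolP.
  exact: loc_le_trans E'E (loc_le_trans EF FF').
exact: loc_le_trans EE' (loc_le_trans EF F'F).
Qed.

Definition upper_set (R : pzRingType) : set_system (locposet R) :=
  [set U | forall x y, (x <= y)%O -> U x -> U y].

Lemma upper_setT (R : pzRingType) : upper_set (@setT (locposet R)).
Proof. by []. Qed.

Lemma upper_setI (R : pzRingType) : setI_closed (@upper_set R).
Proof.
by move=> U V oU oV x y xy [Ux Vx]; split; [exact: oU Ux|exact: oV Vx].
Qed.

Lemma upper_set_bigU (R : pzRingType) (I : Type) (f : I -> set (locposet R)) :
  (forall i, upper_set (f i)) -> upper_set (\bigcup_i f i).
Proof. by move=> fo x y xy [i _ fx]; exists i => //; exact: fo fx. Qed.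

HB.instance Definition _ (R : pzRingType) :=
  isOpenTopological.Build (locposet R) (@upper_setT R) (@upper_setI R)
    (@upper_set_bigU R).

Lemma locposet_openE (R : pzRingType) (U : set (locposet R)) :
  open U <-> forall x y, (x <= y)%O -> U x -> U y.
Proof. by []. Qed.

Lemma locposet_closedE (R : pzRingType) (C : set (locposet R)) :
  closed C <-> forall x y, (x <= y)%O -> C y -> C x.
Proof.
rewrite -openC locposet_openE; split=> h x y xy.
  by move=> Cy; apply: contrapT => /(h _ _ xy).
by move=> nCx /(h _ _ xy).
Qed.

Lemma locposet_closure1 (R : pzRingType) (x : locposet R) :
  closure [set x] = [set y | (y <= x)%O].
Proof.
apply/seteqP; split=> y /=; last first.
  move=> yx; have /locposet_closedE := @closed_closure _ [set x].
  by apply; first exact: yx; exact: subset_closure.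
have cl : closed [set z : locposet R | (z <= x)%O].
  by apply/locposet_closedE => u v uv vx; exact: le_trans vx.
by move=> clxy; apply: cl; apply: closureS clxy => _ ->; exact: lexx.
Qed.

Lemma open_up (R : pzRingType) (E : {fset R}) :
  open [set x | (loc_class E <= x)%O].
Proof. by apply/locposet_openE => x y xy Ex; exact: le_trans xy. Qed.

Definition basic_open (R : pzRingType) (E : {fset R}) : opens (locposet R) :=
  Opens (@open_up R E).

(* The sheaf on an Alexandrov space with sections [loc E] over [basic_open E]
   has as sections over [U] the limit of the [loc E] for [E] in [U]. *)
Record loc_family (R : pzRingType) (U : set (locposet R)) := LocFamily {
  fam :> forall E : {fset R}, U (loc_class E) -> loc [set` E];
  fam_compat : forall (E F : {fset R}) (UE : U (loc_class E))
    (UF : U (loc_class F)) (EF : loc_le [set` E] [set` F]),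
    loc_map EF (fam UE) = fam UF
}.

Lemma loc_family_ext (R : pzRingType) (U : set (locposet R))
    (s t : loc_family U) :
  (forall E (UE : U (loc_class E)), s E UE = t E UE) -> s = t.
Proof.
case: s t => [s sc] [t tc] /= st.
have E : s = t.
  by apply: functional_extensionality_dep => E;
     apply: functional_extensionality_dep => UE; exact: st.
by move: sc tc; rewrite E => sc tc; rewrite (Prop_irrelevance sc tc).
Qed.

HB.instance Definition _ (R : pzRingType) (U : set (locposet R)) :=
  gen_eqMixin (loc_family U).
HB.instance Definition _ (R : pzRingType) (U : set (locposet R)) :=
  gen_choiceMixin (loc_family U).

Definition fam_zero (R : pzRingType) (U : set (locposet R)) : loc_family U.
Proof. by exists (fun E UE => 0) => *; rewrite rmorph0. Defined.
Definition fam_one (R : pzRingType) (U : set (locposet R)) : loc_family U.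
Proof. by exists (fun E UE => 1) => *; rewrite rmorph1. Defined.
Definition fam_opp (R : pzRingType) (U : set (locposet R))
  (s : loc_family U) : loc_family U.
Proof.
exists (fun E UE => - s E UE) => E F UE UF EF.
by rewrite rmorphN (fam_compat s UE UF).
Defined.
Definition fam_add (R : pzRingType) (U : set (locposet R))
  (s t : loc_family U) : loc_family U.
Proof.
exists (fun E UE => s E UE + t E UE) => E F UE UF EF.
by rewrite rmorphD (fam_compat s UE UF) (fam_compat t UE UF).
Defined.
Definition fam_mul (R : pzRingType) (U : set (locposet R))
  (s t : loc_family U) : loc_family U.
Proof.
exists (fun E UE => s E UE * t E UE) => E F UE UF EF.
by rewrite rmorphM (fam_compat s UE UF) (fam_compat t UE UF).
Defined.

Lemma fam_addA (R : pzRingType) (U : set (locposet R)) :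
  associative (@fam_add R U).
Proof. by move=> s t u; apply: loc_family_ext => E UE /=; rewrite addrA. Qed.
Lemma fam_addC (R : pzRingType) (U : set (locposet R)) :
  commutative (@fam_add R U).
Proof. by move=> s t; apply: loc_family_ext => E UE /=; rewrite addrC. Qed.
Lemma fam_add0 (R : pzRingType) (U : set (locposet R)) :
  left_id (fam_zero U) (@fam_add R U).
Proof. by move=> s; apply: loc_family_ext => E UE /=; rewrite add0r. Qed.
Lemma fam_addN (R : pzRingType) (U : set (locposet R)) :
  left_inverse (fam_zero U) (@fam_opp R U) (@fam_add R U).
Proof. by move=> s; apply: loc_family_ext => E UE /=; rewrite addNr. Qed.
Lemma fam_mulA (R : pzRingType) (U : set (locposet R)) :
  associative (@fam_mul R U).
Proof. by move=> s t u; apply: loc_family_ext => E UE /=; rewrite mulrA. Qed.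
Lemma fam_mul1l (R : pzRingType) (U : set (locposet R)) :
  left_id (fam_one U) (@fam_mul R U).
Proof. by move=> s; apply: loc_family_ext => E UE /=; rewrite mul1r. Qed.
Lemma fam_mul1r (R : pzRingType) (U : set (locposet R)) :
  right_id (fam_one U) (@fam_mul R U).
Proof. by move=> s; apply: loc_family_ext => E UE /=; rewrite mulr1. Qed.
Lemma fam_mulDl (R : pzRingType) (U : set (locposet R)) :
  left_distributive (@fam_mul R U) (@fam_add R U).
Proof. by move=> s t u; apply: loc_family_ext => E UE /=; rewrite mulrDl. Qed.
Lemma fam_mulDr (R : pzRingType) (U : set (locposet R)) :
  right_distributive (@fam_mul R U) (@fam_add R U).
Proof. by move=> s t u; apply: loc_family_ext => E UE /=; rewrite mulrDr. Qed.

HB.instance Definition _ (R : pzRingType) (U : set (locposet R)) :=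
  GRing.isPzRing.Build (loc_family U) (@fam_addA R U) (@fam_addC R U)
    (@fam_add0 R U) (@fam_addN R U) (@fam_mulA R U) (@fam_mul1l R U)
    (@fam_mul1r R U) (@fam_mulDl R U) (@fam_mulDr R U).

Definition fam_res_fun (R : pzRingType) (U V : set (locposet R))
  (VU : V `<=` U) (s : loc_family U) : loc_family V :=
  @LocFamily R V (fun E VE => s E (VU _ VE))
    (fun E F VE VF EF => fam_compat s (VU _ VE) (VU _ VF) EF).

Lemma fam_res_zmod (R : pzRingType) (U V : set (locposet R)) (VU : V `<=` U) :
  zmod_morphism (fam_res_fun VU).
Proof. by move=> s t; exact: loc_family_ext. Qed.

Lemma fam_res_monoid (R : pzRingType) (U V : set (locposet R))
    (VU : V `<=` U) : monoid_morphism (fam_res_fun VU).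
Proof. by split=> [|s t]; exact: loc_family_ext. Qed.

Definition fam_res (R : pzRingType) (U V : set (locposet R)) (VU : V `<=` U) :
    {rmorphism loc_family U -> loc_family V} :=
  mk_rmorphism (fam_res_zmod VU) (fam_res_monoid VU).

Lemma fam_irr (R : pzRingType) (U : set (locposet R)) (s : loc_family U)
    (E : {fset R}) (UE UE' : U (loc_class E)) : s E UE = s E UE'.
Proof. by rewrite (Prop_irrelevance UE UE'). Qed.

Lemma fam_res_id (R : pzRingType) (U : opens (locposet R)) (UU : U `<=` U)
    (s : loc_family U) : fam_res UU s = s.
Proof. by apply: loc_family_ext => E UE /=; exact: fam_irr. Qed.

Lemma fam_res_comp (R : pzRingType) (U V W : opens (locposet R))
    (VU : V `<=` U) (WV : W `<=` V) (WU : W `<=` U) (s : loc_family U) :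
  fam_res WV (fam_res VU s) = fam_res WU s.
Proof. by apply: loc_family_ext => E UE /=; exact: fam_irr. Qed.

Lemma fam_glue (R : pzRingType) (I : Type) (Ui : I -> opens (locposet R))
    (U : opens (locposet R)) (s : forall i, loc_family (Ui i)) :
  U = \bigcup_i Ui i :> set (locposet R) ->
  (forall i j, fam_res (@opensIl _ (Ui i) (Ui j)) (s i) =
               fam_res (@opensIr _ (Ui i) (Ui j)) (s j)) ->
  exists! t : loc_family U,
    forall i (UiU : Ui i `<=` U), fam_res UiU t = s i.
Proof.
move=> UE sc.
have agree i j (E : {fset R}) (iE : opens_set (Ui i) (loc_class E))
    (jE : opens_set (Ui j) (loc_class E)) :
    s i E iE = s j E jE.
  have := congr1 (fun t : loc_family _ => t E (conj iE jE)) (sc i j).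
  by move=> /= e; apply: etrans (etrans e _); exact: fam_irr.
have idx (E : {fset R}) : opens_set U (loc_class E) ->
    exists i, opens_set (Ui i) (loc_class E).
  by rewrite UE => -[i _ iE]; exists i.
pose t (E : {fset R}) (h : opens_set U (loc_class E)) :=
  s (sval (cid (idx E h))) E (proj2_sig (cid (idx E h))).
have tc (E F : {fset R}) (hE : opens_set U (loc_class E))
    (hF : opens_set U (loc_class F))
    (EF : loc_le [set` E] [set` F]) : loc_map EF (t E hE) = t F hF.
  rewrite /t; case: (cid (idx E hE)) => i iE; case: (cid (idx F hF)) => j jF.
  change (loc_map EF (s i E iE) = s j F jF).
  have iF : opens_set (Ui i) (loc_class F).
    have /locposet_openE := opens_open (Ui i); apply; last exact: iE.
    exact/loc_class_leP.
  by rewrite (fam_compat (s i) iE iF); exact: agree.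
exists (LocFamily tc); split=> [i UiU|t' t'E].
  by apply: loc_family_ext => E iE; exact: agree.
apply: loc_family_ext => E hE /=; rewrite /t; case: cid => i iE /=.
have UiU : Ui i `<=` U by rewrite UE => x; exists i.
by rewrite -(t'E i UiU) /=; exact: fam_irr.
Qed.

Definition loc_sheaf (R : pzRingType) : ring_sheaf (locposet R) :=
  @RingSheaf (locposet R) (fun U => loc_family U) (fun U V => @fam_res R U V)
    (@fam_res_id R) (@fam_res_comp R) (@fam_glue R).

Definition eval_basic (R : pzRingType) (E : {fset R})
    (s : loc_sheaf R (basic_open E)) : loc [set` E] :=
  fam s (lexx (loc_class E)).

Lemma eval_basic_bij (R : pzRingType) (E : {fset R}) :
  bijective (@eval_basic R E).
Proof.
pose g x : loc_sheaf R (basic_open E) := @LocFamily R (basic_open E)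
  (fun F EF => loc_map (proj1 (loc_class_leP E F) EF) x)
  (fun F G EF EG FG => loc_map_comp _ _ _ x).
exists g => [s|x]; last exact: loc_map_id.
by apply: loc_family_ext => F EF /=; exact: fam_compat.
Qed.

Lemma eval_basic_res (R : pzRingType) (E F : {fset R})
    (EF : loc_le [set` E] [set` F]) (FE : basic_open F `<=` basic_open E)
    (s : loc_sheaf R (basic_open E)) :
  eval_basic (res (loc_sheaf R) FE s) = loc_map EF (eval_basic s).
Proof. by apply/esym; exact: fam_compat. Qed.

Definition NCSpec (R : pzRingType) : ringed_space :=
  soberification (RingedSpace (loc_sheaf R)).

Definition fimage (R S : pzRingType) (theta : {rmorphism R -> S})
  (E : {fset R}) : {fset S} := [fset theta x | x in E]%fset.

Lemma loc_ind_unit (R S : pzRingType) (theta : {rmorphism R -> S})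
    (E : {fset R}) (a : R) : [set` E] a ->
  isunit ((alpha [set` fimage theta E] \o theta : {rmorphism R -> _}) a).
Proof. by move=> Ea; apply: alpha_unit; exact: in_imfset. Qed.

Definition loc_ind (R S : pzRingType) (theta : {rmorphism R -> S})
    (E : {fset R}) : {rmorphism loc [set` E] -> loc [set` fimage theta E]} :=
  loc_lift (@loc_ind_unit R S theta E).

Lemma loc_ind_alpha (R S : pzRingType) (theta : {rmorphism R -> S})
    (E : {fset R}) r :
  loc_ind theta E (alpha [set` E] r) = alpha [set` fimage theta E] (theta r).
Proof. exact: loc_liftE. Qed.

Lemma fimage_le (R S : pzRingType) (theta : {rmorphism R -> S})
    (E F : {fset R}) : loc_le [set` E] [set` F] ->
  loc_le [set` fimage theta E] [set` fimage theta F].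
Proof.
move=> EF b /imfsetP[a aE ->].
by rewrite -loc_ind_alpha; apply: rmorph_isunit; exact: EF.
Qed.

Lemma loc_ind_natural (R S : pzRingType) (theta : {rmorphism R -> S})
    (E F : {fset R}) (G : set S) (EF : loc_le [set` E] [set` F])
    (FG : loc_le [set` fimage theta F] G)
    (EG : loc_le [set` fimage theta E] G) x :
  loc_map FG (loc_ind theta F (loc_map EF x)) = loc_map EG (loc_ind theta E x).
Proof.
apply: (loc_hom_ext (g := loc_map FG \o (loc_ind theta F \o loc_map EF))
  (h := loc_map EG \o loc_ind theta E)) => r.
rewrite -[LHS]/(loc_map FG (loc_ind theta F (loc_map EF (alpha [set` E] r)))).
rewrite -[RHS]/(loc_map EG (loc_ind theta E (alpha [set` E] r))).
by rewrite loc_map_alpha !loc_ind_alpha !loc_map_alpha.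
Qed.

Definition hat_set (R S : pzRingType) (theta : {rmorphism R -> S})
    (C : set (locposet S)) : set (locposet R) :=
  [set loc_class E | E in [set E | C (loc_class (fimage theta E))]].

Lemma hat_setE (R S : pzRingType) (theta : {rmorphism R -> S})
    (C : set (locposet S)) (E : {fset R}) : closed C ->
  hat_set theta C (loc_class E) <-> C (loc_class (fimage theta E)).
Proof.
move=> /locposet_closedE cC; split=> [[F CF /loc_classP[_ EF]]|CE].
  by apply: cC CF; apply/loc_class_leP/fimage_le.
by exists E.
Qed.

Lemma loc_class_leU (R : pzRingType) (E F : {fset R}) (x : locposet R) :
  (loc_class (E `|` F)%fset <= x)%O <->
  (loc_class E <= x)%O /\ (loc_class F <= x)%O.
Proof.
rewrite -(loc_class_reprK x) !loc_class_leP; split.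
  by move=> h; split=> a aE; apply: h; rewrite /= in_fsetU aE ?orbT.
by move=> [hE hF] a /=; rewrite in_fsetU => /orP[/hE|/hF].
Qed.

Lemma fimageU (R S : pzRingType) (theta : {rmorphism R -> S})
    (E F : {fset R}) :
  fimage theta (E `|` F)%fset = (fimage theta E `|` fimage theta F)%fset.
Proof. exact: imfsetU. Qed.

Lemma irreducible_closed_directed (R : pzRingType) (C : set (locposet R))
    (E F : {fset R}) : irreducible_closed C ->
  C (loc_class E) -> C (loc_class F) -> C (loc_class (E `|` F)%fset).
Proof.
move=> [cC _ irr] CE CF; apply: contrapT => nC.
have cE (G : {fset R}) : closed (~` [set x | (loc_class G <= x)%O]).
  exact/open_closedC/open_up.
case: (irr _ _ (cE E) (cE F)).
- move=> x Cx; rewrite -setCI => -[Ex Fx]; apply: nC.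
  have := proj1 (locposet_closedE C) cC; apply; last exact: Cx.
  exact/loc_class_leU.
- by move/(_ _ CE); apply; exact: lexx.
- by move/(_ _ CF); apply; exact: lexx.
Qed.

Lemma hat_irr (R S : pzRingType) (theta : {rmorphism R -> S})
    (C : sober (locposet S)) : irreducible_closed (hat_set theta C).
Proof.
have [cC [x0 Cx0] _] := sober_irr C.
have lC := proj1 (locposet_closedE C) cC.
split.
- apply/locposet_closedE => x y.
  rewrite -(loc_class_reprK x) -(loc_class_reprK y) => /loc_class_leP xy.
  rewrite !hat_setE //; apply: lC.
  exact/loc_class_leP/fimage_le.
- exists (loc_class fset0); apply/hat_setE => //; apply: lC Cx0.
  rewrite -(loc_class_reprK x0); apply/loc_class_leP => b /imfsetP[a /=].
  by rewrite in_fset0.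
- move=> A B /locposet_closedE lA /locposet_closedE lB AB.
  apply: contrapT => /not_orP[/existsNP[x /not_implyP[Cx nAx]]
    /existsNP[y /not_implyP[Cy nBy]]].
  move: Cx nAx Cy nBy; rewrite -(loc_class_reprK x) -(loc_class_reprK y).
  set E := loc_class_repr x; set F := loc_class_repr y.
  rewrite !hat_setE // => CE nAE CF nBF.
  have [le1 le2] := proj1 (loc_class_leU E F _) (lexx _).
  have /AB[Ax|Bx] : hat_set theta C (loc_class (E `|` F)%fset).
    apply/hat_setE => //; rewrite fimageU.
    exact: irreducible_closed_directed (sober_irr C) CE CF.
  + by apply: nAE; exact: lA Ax.
  + by apply: nBF; exact: lB Bx.
Qed.

Definition hat (R S : pzRingType) (theta : {rmorphism R -> S})
    (C : sober (locposet S)) : sober (locposet R) := Sober (hat_irr theta C).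

Definition up_image (R S : pzRingType) (theta : {rmorphism R -> S})
    (U : set (locposet R)) : set (locposet S) :=
  [set y | exists2 E : {fset R}, U (loc_class E) &
                                 (loc_class (fimage theta E) <= y)%O].

Lemma open_up_image (R S : pzRingType) (theta : {rmorphism R -> S})
    (U : set (locposet R)) : open (up_image theta U).
Proof.
by apply/locposet_openE => x y xy [E UE Ex]; exists E => //; exact: le_trans xy.
Qed.

Lemma hat_preim_tilde (R S : pzRingType) (theta : {rmorphism R -> S})
    (U : set (locposet R)) :
  hat theta @^-1` tilde U = tilde (up_image theta U).
Proof.
apply/seteqP; split=> C; have [cC _ _] := sober_irr C.
  move=> [_ [[E CE <-] UE]]; exists (loc_class (fimage theta E)); split=> //.
  by exists E => //; exact: lexx.
move=> [y [Cy [E UE Ey]]]; exists (loc_class E); split=> //.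
exists E => //=; exact: (proj1 (locposet_closedE C) cC) Ey Cy.
Qed.

Lemma continuous_hat (R S : pzRingType) (theta : {rmorphism R -> S}) :
  continuous (hat theta).
Proof.
apply/continuousP => _ [U oU ->]; rewrite hat_preim_tilde.
by apply/sober_openE; exists (up_image theta U) => //; exact: open_up_image.
Qed.

Arguments continuous_hat {R S} theta.

Lemma up_image_basic (R S : pzRingType) (theta : {rmorphism R -> S})
    (E : {fset R}) :
  up_image theta (basic_open E) = basic_open (fimage theta E).
Proof.
apply/seteqP; split=> y /=.
  move=> [F /loc_class_leP EF Fy]; apply: le_trans Fy.
  exact/loc_class_leP/fimage_le.
by move=> Ey; exists E => //; exact: lexx.
Qed.

Definition trace (R : pzRingType) (W : opens (NCSpec R)) : set (locposet R) :=
  @sober_pt (locposet R) @^-1` W.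

Lemma open_trace (R : pzRingType) (W : opens (NCSpec R)) : open (trace W).
Proof.
exact: opens_open (opens_preim (@continuous_sober_pt (locposet R)) W).
Qed.

Lemma trace_hat (R S : pzRingType) (theta : {rmorphism R -> S})
    (W : opens (NCSpec R)) (F : {fset S}) :
  trace (opens_preim (continuous_hat theta) W) (loc_class F) ->
  exists E : {fset R}, trace W (loc_class E) /\
    loc_le [set` fimage theta E] [set` F].
Proof.
case: W => W oW /=; have [U oU WE] := proj1 (sober_openE W) oW.
rewrite WE => -[_ [[E /= clE <-] UE]]; exists E; split.
  change ((@sober_pt (locposet R) @^-1` tilde U) (loc_class E)).
  by rewrite sober_pt_tilde.
by move: clE; rewrite locposet_closure1 => /loc_class_leP.
Qed.

Definition hat_comap_fam (R S : pzRingType) (theta : {rmorphism R -> S})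
    (W : opens (NCSpec R)) (s : loc_family (trace W)) (F : {fset S})
    (h : trace (opens_preim (continuous_hat theta) W) (loc_class F)) :
    loc [set` F] :=
  let E := sval (cid (trace_hat h)) in
  let P := proj2_sig (cid (trace_hat h)) in
  loc_map (proj2 P) (loc_ind theta E (s E (proj1 P))).

Lemma hat_comap_famE (R S : pzRingType) (theta : {rmorphism R -> S})
    (W : opens (NCSpec R)) (s : loc_family (trace W)) (F : {fset S})
    (h : trace (opens_preim (continuous_hat theta) W) (loc_class F))
    (E : {fset R}) (WE : trace W (loc_class E))
    (EF : loc_le [set` fimage theta E] [set` F]) :
  hat_comap_fam s h = loc_map EF (loc_ind theta E (s E WE)).
Proof.
rewrite /hat_comap_fam; case: cid => E' P.
change (loc_map (proj2 P) (loc_ind theta E' (s E' (proj1 P))) =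
        loc_map EF (loc_ind theta E (s E WE))).
move: (proj1 P) (proj2 P) => WE' EF' {P}.
have [/loc_class_leP l l'] := proj1 (loc_class_leU E E' _) (lexx _).
move: l' => /loc_class_leP l'.
have WU : trace W (loc_class (E `|` E')%fset).
  have /locposet_openE := @open_trace _ W; apply; last exact: WE.
  exact/loc_class_leP.
have UF : loc_le [set` fimage theta (E `|` E')%fset] [set` F].
  by rewrite fimageU => a /=; rewrite in_fsetU => /orP[/EF|/EF'].
rewrite -(loc_ind_natural l UF EF) -(loc_ind_natural l' UF EF').
by rewrite !(fam_compat s _ WU).
Qed.

Lemma hat_comap_compat (R S : pzRingType) (theta : {rmorphism R -> S})
    (W : opens (NCSpec R)) (s : loc_family (trace W)) (F G : {fset S})
    (hF : trace (opens_preim (continuous_hat theta) W) (loc_class F))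
    (hG : trace (opens_preim (continuous_hat theta) W) (loc_class G))
    (FG : loc_le [set` F] [set` G]) :
  loc_map FG (hat_comap_fam s hF) = hat_comap_fam s hG.
Proof.
have [E [WE EF]] := trace_hat hF.
rewrite (hat_comap_famE s hF WE EF).
by rewrite (hat_comap_famE s hG WE (loc_le_trans EF FG)); exact: loc_map_comp.
Qed.

Definition hat_comap_fun (R S : pzRingType) (theta : {rmorphism R -> S})
    (W : opens (NCSpec R)) (s : rs_sheaf (NCSpec R) W) :
    rs_sheaf (NCSpec S) (opens_preim (continuous_hat theta) W) :=
  LocFamily (@hat_comap_compat R S theta W s).

Lemma hat_comap_zmod (R S : pzRingType) (theta : {rmorphism R -> S})
    (W : opens (NCSpec R)) : zmod_morphism (@hat_comap_fun R S theta W).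
Proof.
move=> s t; apply: loc_family_ext => F h.
have [E [WE EF]] := trace_hat h.
change (hat_comap_fam (s - t : loc_family (trace W)) h =
        hat_comap_fam s h - hat_comap_fam t h).
by rewrite !(hat_comap_famE _ h WE EF) -!rmorphB.
Qed.

Lemma hat_comap_monoid (R S : pzRingType) (theta : {rmorphism R -> S})
    (W : opens (NCSpec R)) : monoid_morphism (@hat_comap_fun R S theta W).
Proof.
split=> [|s t]; apply: loc_family_ext => F h; have [E [WE EF]] := trace_hat h.
  change (hat_comap_fam (1 : loc_family (trace W)) h = 1).
  by rewrite (hat_comap_famE _ h WE EF) [X in loc_ind _ _ X]/(1) !rmorph1.
change (hat_comap_fam (s * t : loc_family (trace W)) h =
        hat_comap_fam s h * hat_comap_fam t h).
by rewrite !(hat_comap_famE _ h WE EF) -!rmorphM.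
Qed.

Definition hat_comap (R S : pzRingType) (theta : {rmorphism R -> S})
    (W : opens (NCSpec R)) :
    {rmorphism rs_sheaf (NCSpec R) W ->
       rs_sheaf (NCSpec S) (opens_preim (continuous_hat theta) W)} :=
  mk_rmorphism (@hat_comap_zmod R S theta W) (@hat_comap_monoid R S theta W).

Lemma hat_comap_natural (R S : pzRingType) (theta : {rmorphism R -> S})
    (U V : opens (NCSpec R)) (VU : V `<=` U) (s : rs_sheaf (NCSpec R) U) :
  hat_comap theta V (res (rs_sheaf (NCSpec R)) VU s) =
  res (rs_sheaf (NCSpec S)) (opens_preimS (continuous_hat theta) VU)
    (hat_comap theta U s).
Proof.
apply: loc_family_ext => F h; have [E [VE EF]] := trace_hat h.
apply: etrans (hat_comap_famE _ h VE EF) _; apply/esym.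
exact: (hat_comap_famE s (opens_preimS (continuous_hat theta) VU _ h)
  (opens_preimS (@continuous_sober_pt (locposet R)) VU _ VE) EF).
Qed.

Definition NCSpec_map (R S : pzRingType) (theta : {rmorphism R -> S}) :
    rs_hom (NCSpec S) (NCSpec R) :=
  @RSHom (NCSpec S) (NCSpec R) (hat theta) (continuous_hat theta)
    (hat_comap theta) (@hat_comap_natural R S theta).

Lemma hat_preim_basic (R S : pzRingType) (theta : {rmorphism R -> S})
    (E : {fset R}) :
  hat theta @^-1` tilde (basic_open E) = tilde (basic_open (fimage theta E)).
Proof. by rewrite hat_preim_tilde up_image_basic. Qed.

Lemma hat_comap_basic (R S : pzRingType) (theta : {rmorphism R -> S})
    (W : opens (NCSpec R)) (s : rs_sheaf (NCSpec R) W) (E : {fset R})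
    (WE : trace W (loc_class E))
    (h : trace (opens_preim (continuous_hat theta) W)
           (loc_class (fimage theta E))) :
  fam (hat_comap theta W s) h = loc_ind theta E (fam s WE).
Proof.
by apply: etrans (hat_comap_famE s h WE (@loc_le_refl _ _)) _; exact: loc_map_id.
Qed.

Definition NCSpec_prim_map
    (H : forall (R S : pzRingType) (theta : {rmorphism R -> S}),
      prim (NCSpec_map theta)) (S R : opposite rings) (theta : cat_hom S R) :
    @cat_hom prim_ringed_spaces (NCSpec S) (NCSpec R) :=
  exist _ (NCSpec_map theta) (H R S theta).

(* Main.v *)
(* The sections of NCSpec(R) over the basic open set of E form the localization
   of R at E, and the basic open sets are exactly the completely
   cup-irreducible ones; the whole space is the basic open set of the empty
   set. The global sections of phi thus define theta : R -> S. If phi is prim,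
   the preimage of the basic open set of E is that of some finite G in S, and
   the pushout square over the whole space exhibits loc(S, G) as the pushout of
   S <- R -> loc(R, E), that is, as loc(S, theta(E)). Hence phi and the morphism
   induced by theta agree on basic open sets, so they are equal. *)

Require Import Defs.
From mathcomp Require Import all_boot all_order all_algebra.
From mathcomp Require Import finmap.
From mathcomp Require Import boolp classical_sets topology_structure.

Set Implicit Arguments.
Unset Strict Implicit.
Unset Printing Implicit Defensive.

Import Order.TTheory GRing.Theory.
Local Open Scope classical_set_scope.
Local Open Scope ring_scope.

(** * Localizations and pushouts of rings *)

(** A property of a morphism rather than the ring [loc A] itself: sections are compatible families,
    and open sets with the same points may have distinct section rings, so the universal property
    replaces transport along isomorphisms. *)
Definition is_localization (R L : pzRingType) (A : set R)
    (f : {rmorphism R -> L}) : Prop :=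
  (forall a, A a -> isunit (f a)) /\
  forall (T : pzRingType) (g : {rmorphism R -> T}),
    (forall a, A a -> isunit (g a)) ->
    exists! h : {rmorphism L -> T}, forall r, h (f r) = g r.

Section Localization.
Variables (R L : pzRingType) (A : set R) (f : {rmorphism R -> L}).
Hypothesis locf : is_localization A f.

Lemma localization_lift (T : pzRingType) (g : {rmorphism R -> T}) :
  (forall a, A a -> isunit (g a)) ->
  exists h : {rmorphism L -> T}, forall r, h (f r) = g r.
Proof. by move=> gA; have [h [hE _]] := proj2 locf T g gA; exists h. Qed.

Lemma localization_ext (T : pzRingType) (g h : {rmorphism L -> T}) :
  (forall r, g (f r) = h (f r)) -> g =1 h.
Proof.
move=> gh x; have [|k [_ kU]] := proj2 locf T (g \o f : {rmorphism R -> T}).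
  by move=> a Aa /=; apply: rmorph_isunit; exact: (proj1 locf).
by rewrite -(kU g (fun=> erefl)) (kU h) // => r /=; rewrite gh.
Qed.

End Localization.

(** By universality at [B], [alpha B] factors through [f], which already inverts [A]. *)
Lemma localization_le (R L : pzRingType) (A B : set R) (f : {rmorphism R -> L}) :
  is_localization A f -> is_localization B f -> loc_le A B.
Proof.
move=> [fA _] fB a Aa; have [h hE] := localization_lift fB (@alpha_unit R B).
by rewrite -hE; apply: rmorph_isunit; exact: fA.
Qed.

(** A cocone [(u, v)] amounts to a map [u \o b] out of [S]. It agrees on [R] with [v \o c], which
    inverts [F]; so it inverts the image of [F] and extends to [D]. *)
Lemma localization_pushout (R S A B C D : pzRingType) (E F : set R)
    (theta : {rmorphism R -> S}) (a : {rmorphism R -> A})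
    (b : {rmorphism S -> B}) (c : {rmorphism R -> C}) (d : {rmorphism S -> D})
    (f : {rmorphism A -> B}) (g : {rmorphism A -> C})
    (i : {rmorphism B -> D}) (j : {rmorphism C -> D}) :
  is_localization E a -> is_localization (theta @` E) b ->
  is_localization F c -> is_localization (theta @` F) d ->
  (forall r, f (a r) = b (theta r)) -> (forall r, g (a r) = c r) ->
  (forall s, i (b s) = d s) -> (forall r, j (c r) = d (theta r)) ->
  is_pushout f g i j.
Proof.
move=> la lb lc ld fa ga ib jc; split=> [|T u v uv].
  apply: (localization_ext la (g := i \o f) (h := j \o g)) => r /=.
  by rewrite fa ib ga jc.
have ubv r : u (b (theta r)) = v (c r) by rewrite -fa uv ga.
have [|w wd] := localization_lift ld (g := u \o b).
  by move=> _ [r Fr <-] /=; rewrite ubv; apply/rmorph_isunit/(proj1 lc).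
exists w; split=> [|z [zi zj]].
  split.
    by apply: (localization_ext lb (g := w \o i)) => s /=; rewrite ib wd.
  by apply: (localization_ext lc (g := w \o j)) => r /=; rewrite jc wd /= ubv.
by apply/rmorphism_ext/(localization_ext ld) => s; rewrite wd -ib zi.
Qed.

(** A partial converse: a map [k] out of [S] inverting the image of [F] extends to [B], while
    [k \o theta] extends to [C]. These extensions form a cocone, and the pushout property turns it
    into a map out of [D]. *)
Lemma pushout_localization (R S A B C D : pzRingType) (F : set R)
    (theta : {rmorphism R -> S}) (a : {rmorphism R -> A})
    (b : {rmorphism S -> B}) (c : {rmorphism R -> C}) (d : {rmorphism S -> D})
    (f : {rmorphism A -> B}) (g : {rmorphism A -> C})
    (i : {rmorphism B -> D}) (j : {rmorphism C -> D}) :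
  is_localization set0 a -> is_localization set0 b -> is_localization F c ->
  (forall r, f (a r) = b (theta r)) -> (forall r, g (a r) = c r) ->
  (forall s, i (b s) = d s) -> is_pushout f g i j ->
  is_localization (theta @` F) d.
Proof.
move=> la lb lc fa ga ib [sq univ].
have jc r : j (c r) = d (theta r) by rewrite -ga -sq fa ib.
split=> [_ [r Fr <-]|T k kF].
  by rewrite -jc; apply/rmorph_isunit/(proj1 lc).
have [//|u ub] := localization_lift lb (g := k).
have [|v vc] := localization_lift lc (g := k \o theta).
  by move=> r Fr /=; apply: kF; exists r.
have [|w [[wi wj] wU]] := univ T u v.
  apply: (localization_ext la (g := u \o f) (h := v \o g)) => r /=.
  by rewrite fa ub ga vc.
exists w; split=> [s|z zd]; first by rewrite -ib wi.
apply: wU; split.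
  by apply: (localization_ext lb (g := z \o i)) => s /=; rewrite ib zd.
by apply: (localization_ext lc (g := z \o j)) => r /=; rewrite jc zd.
Qed.

(** * Sections over an open set with a least element *)

Section Sections.
Variable R : pzRingType.

Definition base_fam (U : set (locposet R)) (r : R) : loc_family U :=
  @LocFamily R U (fun E _ => alpha [set` E] r)
    (fun E F _ _ EF => loc_map_alpha EF r).

Lemma base_fam_zmod (U : set (locposet R)) : zmod_morphism (base_fam U).
Proof. by move=> r s; apply: loc_family_ext => E UE; exact: rmorphB. Qed.

Lemma base_fam_monoid (U : set (locposet R)) : monoid_morphism (base_fam U).
Proof.
by split=> [|r s]; apply: loc_family_ext => E UE;
  [exact: rmorph1|exact: rmorphM].
Qed.

Definition base_section (U : set (locposet R)) : {rmorphism R -> loc_family U} :=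
  mk_rmorphism (@base_fam_zmod U) (@base_fam_monoid U).

Lemma fam_eval_zmod (U : set (locposet R)) E (UE : U (loc_class E)) :
  zmod_morphism (fun s : loc_family U => s E UE).
Proof. by []. Qed.

Lemma fam_eval_monoid (U : set (locposet R)) E (UE : U (loc_class E)) :
  monoid_morphism (fun s : loc_family U => s E UE).
Proof. by []. Qed.

Definition fam_eval (U : set (locposet R)) E (UE : U (loc_class E)) :
    {rmorphism loc_family U -> loc [set` E]} :=
  mk_rmorphism (fam_eval_zmod UE) (fam_eval_monoid UE).

Section Least.
Variables (U : set (locposet R)) (E : {fset R}).
Hypothesis Umin : forall F, U (loc_class F) -> loc_le [set` E] [set` F].

Definition spread_fam (x : loc [set` E]) : loc_family U :=
  @LocFamily R U (fun F UF => loc_map (Umin UF) x)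
    (fun F G UF UG FG => loc_map_comp _ _ _ x).

Lemma spread_fam_zmod : zmod_morphism spread_fam.
Proof. by move=> x y; apply: loc_family_ext => F UF; exact: rmorphB. Qed.

Lemma spread_fam_monoid : monoid_morphism spread_fam.
Proof.
by split=> [|x y]; apply: loc_family_ext => F UF;
  [exact: rmorph1|exact: rmorphM].
Qed.

Definition spread : {rmorphism loc [set` E] -> loc_family U} :=
  mk_rmorphism spread_fam_zmod spread_fam_monoid.

Lemma spread_alpha r : spread (alpha [set` E] r) = base_section U r.
Proof. by apply: loc_family_ext => F UF; exact: loc_map_alpha. Qed.

Hypothesis UE : U (loc_class E).

Lemma fam_evalK : cancel (fam_eval UE) spread.
Proof. by move=> s; apply: loc_family_ext => F UF; exact: fam_compat. Qed.

(** [spread] recovers a section from its value at the least element [loc_class E], and that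
    evaluation takes [base_section] to [alpha]; the universal property of [loc] carries over. *)
Lemma base_section_localization : is_localization [set` E] (base_section U).
Proof.
split=> [a Ea|T g gE].
  by rewrite -spread_alpha; apply/rmorph_isunit/alpha_unit.
exists (loc_lift gE \o fam_eval UE); split=> [r|h hE].
  exact: loc_liftE.
have hS : loc_lift gE =1 h \o spread.
  by apply: loc_hom_ext => r; rewrite loc_liftE -hE -spread_alpha.
by apply: rmorphism_ext => s; rewrite -[in RHS](fam_evalK s); exact: hS.
Qed.

End Least.
End Sections.

(** * Basic open sets and complete irreducibility *)

Section Topology.
Variable R : pzRingType.

Lemma tilde_basicE (C : sober (locposet R)) (E : {fset R}) :
  tilde (basic_open E) C <-> sober_set C (loc_class E).
Proof.
have [/locposet_closedE lC _ _] := sober_irr C.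
split=> [[x [Cx Ex]]|CE]; first exact: lC Cx.
by exists (loc_class E); split=> //; exact: lexx.
Qed.

Lemma sober_pt_mem (x y : locposet R) : sober_set (sober_pt x) y <-> (y <= x)%O.
Proof. by rewrite /= locposet_closure1. Qed.

(** The basic open set is the smallest neighbourhood of the point of [E]: [W] comes from an upper
    set meeting the lower set below [loc_class E], hence containing [loc_class E]. *)
Lemma tilde_basic_subset (E : {fset R}) (W : set (sober (locposet R))) :
  open W -> W (sober_pt (loc_class E)) -> tilde (basic_open E) `<=` W.
Proof.
move=> [U /locposet_openE oU ->] [y [/sober_pt_mem yE Uy]] C /tilde_basicE CE.
by exists (loc_class E); split=> //; exact: oU Uy.
Qed.

Lemma sober_pt_basic (E F : {fset R}) :
  tilde (basic_open E) (sober_pt (loc_class F)) <->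
  loc_le [set` E] [set` F].
Proof. by rewrite tilde_basicE sober_pt_mem loc_class_leP. Qed.

Lemma open_tilde_basic (E : {fset R}) :
  open (tilde (basic_open E) : set (NCSpec R)).
Proof. by apply/sober_openE; exists (basic_open E) => //; exact: open_up. Qed.

Definition basic_NC (E : {fset R}) : opens (NCSpec R) :=
  Opens (open_tilde_basic E).

(** Every open set is a union of basic ones. Conversely, in a cover of a basic open set, the member
    containing the point of [E] contains its smallest neighbourhood, hence is everything. *)
Lemma cup_irreducibleE (W : set (NCSpec R)) :
  cup_irreducible W <-> exists E : {fset R}, W = tilde (basic_open E).
Proof.
split=> [[oW Wirr]|[E ->]].
  (* The basic open sets contained in [W], selected by their defining points. *)
  pose F := [set (tilde (basic_open E) : set (NCSpec R)) |
              E in [set E : {fset R} | W (sober_pt (loc_class E))]].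
  case: (Wirr F) => [_ [E _ <-]||E _ <-]; last by exists E.
    exact: open_tilde_basic.
  apply/seteqP; split=> C; last first.
    by move=> [_ [E WE <-]]; exact: tilde_basic_subset.
  have [U /locposet_openE oU WU] := proj1 (sober_openE W) oW.
  rewrite {1}WU => -[x [Cx Ux]]; set E := loc_class_repr x.
  have xE : x = loc_class E by rewrite loc_class_reprK.
  exists (tilde (basic_open E)).
    exists E => //=; rewrite WU; exists x; split=> //.
    by rewrite -xE; apply/sober_pt_mem.
  by apply/tilde_basicE; rewrite -xE.
split=> [|F oF EF]; first exact: open_tilde_basic.
have [V FV VE] : (\bigcup_(V in F) V) (sober_pt (loc_class E) : NCSpec R).
  by rewrite -EF; apply/sober_pt_basic/loc_le_refl.
suff -> : tilde (basic_open E) = V by [].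
apply/seteqP; split; last by rewrite EF => C VC; exists V.
by apply: tilde_basic_subset => //; exact: oF.
Qed.

(** The trace of [W] on the poset has least element [loc_class E]. *)
Lemma NCSpec_section_localization (W : opens (NCSpec R)) (E : {fset R}) :
  W = tilde (basic_open E) :> set _ ->
  is_localization [set` E] (base_section (trace W)).
Proof.
move=> WE; apply: base_section_localization => [F|].
  by rewrite /trace WE => /sober_pt_basic.
by rewrite /trace WE; apply/sober_pt_basic/loc_le_refl.
Qed.

End Topology.

(** * The ring homomorphism read off from global sections *)

(** This constrains only sections coming from [R]; the action on points and on other sections must
    be derived from it, and for that [prim] is used. *)
Definition induces (R S : pzRingType) (phi : rs_hom (NCSpec S) (NCSpec R))
    (theta : {rmorphism R -> S}) : Prop :=
  forall (W : opens (NCSpec R)) (r : R),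
    rs_comap phi W (base_section (trace W) r) =
    base_section (trace (opens_preim (rs_cont phi) W)) (theta r).

Lemma base_section_res (R : pzRingType) (U V : opens (NCSpec R))
    (VU : V `<=` U) (r : R) :
  res (rs_sheaf (NCSpec R)) VU (base_section (trace U) r) =
  base_section (trace V) r.
Proof. exact: loc_family_ext. Qed.

Lemma fimageE (R S : pzRingType) (theta : {rmorphism R -> S}) (E : {fset R}) :
  [set` fimage theta E] = theta @` [set` E].
Proof.
apply/seteqP; split=> y /=; first by move=> /imfsetP[a aE ->]; exists a.
by move=> [a aE <-]; exact: in_imfset.
Qed.

Lemma NCSpec_map_induces (R S : pzRingType) (theta : {rmorphism R -> S}) :
  induces (NCSpec_map theta) theta.
Proof.
move=> W r; apply: loc_family_ext => F h; have [E [WE EF]] := trace_hat h.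
apply: etrans (hat_comap_famE _ h WE EF) _.
exact: etrans (congr1 (loc_map EF) (loc_ind_alpha theta E r))
  (loc_map_alpha _ _).
Qed.

(** The class of the empty set is least, hence lies in every nonempty lower set. *)
Lemma basic_NC0 (R : pzRingType) : basic_NC (fset0 : {fset R}) = setT :> set _.
Proof.
apply/seteqP; split=> C // _; apply/tilde_basicE.
have [/locposet_closedE lC [x Cx] _] := sober_irr C; apply: lC Cx.
by rewrite -(loc_class_reprK x); apply/loc_class_leP => a /=; rewrite inE.
Qed.

Lemma set_fset0 (R : pzRingType) : [set` (fset0 : {fset R})] = set0.
Proof. by apply/seteqP; split=> a //=; rewrite inE. Qed.

Lemma global_localization (R : pzRingType) (W : opens (NCSpec R)) :
  W = setT :> set _ -> is_localization set0 (base_section (trace W)).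
Proof.
move=> WT; rewrite -(@set_fset0 R).
by apply: (NCSpec_section_localization (E := fset0)); rewrite WT -basic_NC0.
Qed.

Lemma preim_global_localization (R S : pzRingType)
    (phi : rs_hom (NCSpec S) (NCSpec R)) :
  is_localization set0
    (base_section (trace (opens_preim (rs_cont phi) (basic_NC fset0)))).
Proof.
apply: (global_localization (W := opens_preim (rs_cont phi) (basic_NC fset0))).
by rewrite [LHS]/= -[tilde _]/(opens_set (basic_NC fset0)) basic_NC0.
Qed.

Lemma localization0_bij (R L : pzRingType) (f : {rmorphism R -> L}) :
  is_localization set0 f ->
  exists g : {rmorphism L -> R}, cancel f g /\ cancel g f.
Proof.
move=> lf; have [//|g gf] := localization_lift lf (g := idfun).
exists g; split=> // x.
by apply: (localization_ext lf (g := f \o g) (h := idfun)) => r /=; rewrite gf.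
Qed.

(** Global sections on the two sides are [R] and [S], so the global component of [phi] yields
    [theta]; naturality of restriction from [T] to [W] propagates the relation to every [W]. *)
Lemma exists_induces (R S : pzRingType) (phi : rs_hom (NCSpec S) (NCSpec R)) :
  exists theta : {rmorphism R -> S}, induces phi theta.
Proof.
pose T := basic_NC (fset0 : {fset R}).
have [g [fK gK]] := localization0_bij (preim_global_localization phi).
exists (g \o (rs_comap phi T \o base_section (trace T))) => W r.
have WT : W `<=` T by rewrite basic_NC0.
rewrite -(base_section_res WT) rs_natural.
rewrite -[in RHS](base_section_res (opens_preimS (rs_cont phi) WT)).
by rewrite [in RHS]gK.
Qed.

Lemma induces_inj (R S : pzRingType) (phi : rs_hom (NCSpec S) (NCSpec R))
    (theta theta' : {rmorphism R -> S}) :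
  induces phi theta -> induces phi theta' -> theta = theta'.
Proof.
pose T := basic_NC (fset0 : {fset R}).
have [g [fK gK]] := localization0_bij (preim_global_localization phi).
move=> i i'; apply: rmorphism_ext => r.
by rewrite -[LHS]fK -(i T) (i' T) fK.
Qed.

(** * Prim morphisms are determined by their ring homomorphism *)

(** The sections over the preimage localize [S] both at [G], by irreducibility, and at the image of
    [E], by the pushout square; comparing both ways equates the two classes. *)
Lemma preim_basic_induces (R S : pzRingType)
    (phi : rs_hom (NCSpec S) (NCSpec R)) (theta : {rmorphism R -> S})
    (E : {fset R}) :
  prim phi -> induces phi theta ->
  phi @^-1` tilde (basic_open E) = tilde (basic_open (fimage theta E)).
Proof.
move=> pphi ind.
pose T := basic_NC (fset0 : {fset R}).
have Tirr : cup_irreducible T by apply/cup_irreducibleE; exists fset0.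
have Eirr : cup_irreducible (basic_NC E) by apply/cup_irreducibleE; exists E.
have ET : basic_NC E `<=` T by rewrite basic_NC0.
have [G GE] := proj1 (cup_irreducibleE _) (proj1 (pphi _ Eirr)).
have lG := NCSpec_section_localization GE.
have lA := global_localization (@basic_NC0 R).
have lB := preim_global_localization phi.
have lC : is_localization [set` E] (base_section (trace (basic_NC E))).
  exact: NCSpec_section_localization.
have lE := pushout_localization lA lB lC (ind T) (base_section_res ET)
  (base_section_res (opens_preimS (rs_cont phi) ET))
  (proj2 (pphi _ Tirr) _ ET Eirr).
rewrite -fimageE in lE.
have {lE lG} clG : loc_class G = loc_class (fimage theta E).
  by apply/loc_classP; split;
    [exact: localization_le lG lE|exact: localization_le lE lG].
by apply: etrans GE _; rewrite /= clG.
Qed.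

Lemma trace_basic_subset (R : pzRingType) (W : opens (NCSpec R))
    (E : {fset R}) : trace W (loc_class E) -> basic_NC E `<=` W.
Proof. by move=> WE; apply: tilde_basic_subset => //; exact: opens_open. Qed.

Lemma trace_preim_fimage (R S : pzRingType)
    (phi : rs_hom (NCSpec S) (NCSpec R)) (theta : {rmorphism R -> S})
    (W : opens (NCSpec R)) (E : {fset R}) :
  trace W (loc_class E) -> prim phi -> induces phi theta ->
  trace (opens_preim (rs_cont phi) W) (loc_class (fimage theta E)).
Proof.
move=> WE pphi ind; apply: (trace_basic_subset WE).
suff : (phi @^-1` tilde (basic_open E)) (sober_pt (loc_class (fimage theta E))).
  by [].
by rewrite (preim_basic_induces _ pphi ind); apply/sober_pt_basic/loc_le_refl.
Qed.

Lemma induces_basic (R S : pzRingType) (phi : rs_hom (NCSpec S) (NCSpec R))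
    (theta : {rmorphism R -> S}) (W : opens (NCSpec R)) (E : {fset R})
    (s : rs_sheaf (NCSpec R) W) (WE : trace W (loc_class E))
    (h : trace (opens_preim (rs_cont phi) W) (loc_class (fimage theta E))) :
  prim phi -> induces phi theta ->
  fam (rs_comap phi W s) h = loc_ind theta E (fam s WE).
Proof.
move=> pphi ind.
have BW := trace_basic_subset WE.
have BE : trace (basic_NC E) (loc_class E).
  exact/sober_pt_basic/loc_le_refl.
have hB := trace_preim_fimage BE pphi ind.
have lE : is_localization [set` E] (base_section (trace (basic_NC E))).
  exact: NCSpec_section_localization.
(* Over the basic open set of [E] the sections localize [R], so agreement on elements of [R]
   suffices; naturality then reaches [W]. *)
have key : fam_eval hB \o rs_comap phi (basic_NC E) =1
    loc_ind theta E \o fam_eval BE.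
  apply: (localization_ext lE) => r.
  exact: etrans (congr1 (fam_eval hB) (ind (basic_NC E) r))
    (esym (loc_ind_alpha theta E r)).
have := key (res (rs_sheaf (NCSpec R)) BW s).
rewrite /= rs_natural => e.
by apply: etrans (etrans e _); rewrite /=; [|congr (loc_ind _ _ _)];
  exact: fam_irr.
Qed.

(** A point is determined by the basic open sets containing it, which settles the maps on points. *)
Lemma prim_induces_eq (R S : pzRingType)
    (phi : rs_hom (NCSpec S) (NCSpec R)) (theta : {rmorphism R -> S}) :
  prim phi -> induces phi theta -> phi = NCSpec_map theta.
Proof.
move=> pphi ind; apply: rs_hom_ext => [C|W hW s].
  apply/sober_ext/seteqP.
  suff H (x : locposet R) : sober_set (phi C) x <-> hat_set theta C x.
    by split=> x /H.
  rewrite -(loc_class_reprK x); set E := loc_class_repr x.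
  have [cC _ _] := sober_irr C.
  rewrite (hat_setE _ _ cC) -!tilde_basicE.
  by rewrite -[tilde _ (phi C)]/((phi @^-1` tilde (basic_open E)) C)
    (preim_basic_induces _ pphi ind).
apply: loc_family_ext => F h.
(* Both values at [F] are images of the value at [fimage theta E], where [induces_basic] applies. *)
have [E [WE EF]] := trace_hat h.
apply: etrans (esym (hat_comap_famE s h WE EF)).
have hE := trace_preim_fimage WE pphi ind.
rewrite -(induces_basic s WE hE pphi ind).
by apply/esym; exact: fam_compat.
Qed.

(** The corners of the square are localizations at [E], [F] and their images under [theta], as
    [localization_pushout] requires. *)
Lemma NCSpec_map_prim (R S : pzRingType) (theta : {rmorphism R -> S}) :
  prim (NCSpec_map theta).
Proof.
move=> U /cup_irreducibleE[E UE].
have hU : hat theta @^-1` U = tilde (basic_open (fimage theta E)).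
  by rewrite UE hat_preim_basic.
split=> [|V VU /cup_irreducibleE[F VF]].
  by apply/cup_irreducibleE; exists (fimage theta E).
have hV : hat theta @^-1` V = tilde (basic_open (fimage theta F)).
  by rewrite VF hat_preim_basic.
have ind := @NCSpec_map_induces R S theta.
have lU := NCSpec_section_localization UE.
have lV := NCSpec_section_localization VF.
have lhU := NCSpec_section_localization
  (W := opens_preim (@continuous_hat R S theta) U) hU.
have lhV := NCSpec_section_localization
  (W := opens_preim (@continuous_hat R S theta) V) hV.
rewrite fimageE in lhU; rewrite fimageE in lhV.
apply: (localization_pushout lU lhU lV lhV (ind U) (base_section_res VU) _
  (ind V)).
exact: base_section_res.
Qed.

Lemma induced_iff_prim (R S : pzRingType)
    (phi : rs_hom (NCSpec S) (NCSpec R)) :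
  (exists theta : {rmorphism R -> S}, phi = NCSpec_map theta) <-> prim phi.
Proof.
split=> [[theta ->]|pphi]; first exact: NCSpec_map_prim.
by have [theta ind] := exists_induces phi; exists theta; exact: prim_induces_eq.
Qed.

(** * Functoriality and full faithfulness *)

Lemma NCSpec_map_id (R : pzRingType) : NCSpec_map idfun = rs_id (NCSpec R).
Proof.
apply/esym/prim_induces_eq; first exact: prim_id.
by move=> W r; exact: base_section_res.
Qed.

(** The composite is prim and induces [g \o f], so uniqueness replaces a comparison of points and
    sections. *)
Lemma NCSpec_map_comp (R S T : pzRingType) (f : {rmorphism R -> S})
    (g : {rmorphism S -> T}) :
  NCSpec_map (g \o f) = rs_comp (NCSpec_map f) (NCSpec_map g).
Proof.
apply/esym/prim_induces_eq; first by apply: prim_comp; exact: NCSpec_map_prim.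
move=> W r; have hf := NCSpec_map_induces f W r.
have hg := NCSpec_map_induces g (opens_preim (@continuous_hat R S f) W) (f r).
apply: etrans (congr1 _ (etrans (congr1 _ hf) hg)) _.
exact: base_section_res.
Qed.

Section FullyFaithful.
Variables (C D : category) (F0 : C -> D).
Variable F1 : forall a b, cat_hom a b -> cat_hom (F0 a) (F0 b).

(** Fullness lifts the two inverse morphisms; faithfulness lifts the identities between their
    composites. *)
Lemma fully_faithful_reflects_iso : is_functor F1 -> fully_faithful F1 ->
  forall a b, isomorphic (F0 a) (F0 b) -> isomorphic a b.
Proof.
move=> [F1id F1comp] ff a b [f [g [gf fg]]].
have [f' _ fK] := ff a b; have [g' _ gK] := ff b a.
exists (f' f), (g' g); split; apply: bij_inj (ff _ _) _ _ _.
  by rewrite F1comp fK gK F1id.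
by rewrite F1comp fK gK F1id.
Qed.

End FullyFaithful.

Theorem theorem7p7 :
  (forall (R S : pzRingType) (phi : rs_hom (NCSpec S) (NCSpec R)),
     (exists theta : {rmorphism R -> S}, phi = NCSpec_map theta) <-> prim phi) /\
  (exists H : (forall (R S : pzRingType) (theta : {rmorphism R -> S}),
                 prim (NCSpec_map theta)),
     is_full_embedding (NCSpec_prim_map H)).
Proof.
split; first exact: induced_iff_prim.
exists NCSpec_map_prim.
have func : is_functor (NCSpec_prim_map NCSpec_map_prim).
  split=> [R|S R T g f]; apply: prim_hom_ext; first exact: NCSpec_map_id.
  exact: NCSpec_map_comp.
have ff : fully_faithful (NCSpec_prim_map NCSpec_map_prim).
  move=> S R.
  have surj (phi : prim_hom (NCSpec S) (NCSpec R)) :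
      exists theta : {rmorphism R -> S}, NCSpec_map theta = sval phi.
    by have [theta e] := proj2 (induced_iff_prim _) (svalP phi); exists theta.
  exists (fun phi => sval (cid (surj phi))) => [theta|phi];
      case: cid => theta' e /=.
    (* Faithfulness: the chosen [theta'] and the original [theta] are induced by one and the same
       morphism. *)
    apply: (induces_inj (phi := NCSpec_map theta')).
      exact: NCSpec_map_induces.
    by rewrite e; exact: NCSpec_map_induces.
  exact: prim_hom_ext.
by split=> //; exact: fully_faithful_reflects_iso func ff.
Qed.
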